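(* Let $V:\mathcal{K}^n\to\mathbb{R}$ be a translation invariant valuation which is bounded on $\mathcal{K}(B)$. If $V$ is $m$-homogeneous, then $m\in[0,n-1]\cup\{n\}$. Moreover, for each $m\in[0,n-1]\cup\{n\}$, there exists a translation invariant valuation $V$ on $\mathcal{K}^n$ that is bounded on $\mathcal{K}(B)$ and $m$-homogeneous.
   Context: $\mathcal{K}^n$ is the set of convex bodies in $\mathbb{R}^n$, i.e. the convex, compact and nonempty subsets of $\mathbb{R}^n$. $B$ is the closed Euclidean unit ball of $\mathbb{R}^n$ and $\mathcal{K}(B)=\{K\in\mathcal{K}^n: K\subset B\}$. A map $V:\mathcal{K}^n\to\mathbb{R}$ is a valuation if $V(K\cup L)+V(K\cap L)=V(K)+V(L)$ for all $K,L\in\mathcal{K}^n$ with $K\cup L\in\mathcal{K}^n$. It is translation invariant if $V(K+x)=V(K)$ for all $K\in\mathcal{K}^n$ and $x\in\mathbb{R}^n$. It is bounded on $\mathcal{K}(B)$ if $\sup_{K\in\mathcal{K}(B)}|V(K)|<\infty$. It is $m$-homogeneous if $V(\lambda K)=\lambda^m V(K)$ for every $\lambda\ge 0$ and every $K\in\mathcal{K}^n$.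
   Formalization: The valuation V is required not to vanish identically: V = 0 is m-homogeneous for every m, so the first claim fails without this; the valuations shown to exist in the second claim are likewise proved to be not identically zero. *)

(* Defs.v *)
From HB Require Import structures.
From mathcomp Require Import all_boot all_order all_algebra.
From mathcomp Require Import all_classical all_reals all_analysis.

Set Implicit Arguments.
Unset Strict Implicit.
Unset Printing Implicit Defensive.

Import Order.TTheory GRing.Theory Num.Theory.
Import numFieldNormedType.Exports.

Local Open Scope classical_set_scope.
Local Open Scope ring_scope.

(* The library norm on 'rV[R]_n is the sup norm: it induces the usual
   topology (used for compactness) but its unit ball is a cube. *)
Definition euclidean_norm (R : realType) (n : nat) (x : 'rV[R]_n) : R :=
  Num.sqrt (\sum_(i < n) x ord0 i ^+ 2).

Definition euclidean_ball (R : realType) (n : nat) : set 'rV[R]_n :=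
  [set x | euclidean_norm x <= 1].

Definition convex_body (R : realType) (n : nat) : set (set 'rV[R]_n) :=
  [set K : set 'rV[R]_n | [/\ convex_set K, compact K & K !=set0]].

(* Below, a map on convex bodies is a total map V on all subsets of R^n, of
   which only the values on convex bodies are ever used. *)

(* When K, L and K `|` L are convex bodies, so is K `&` L: it is nonempty
   because K `|` L is connected while K and L are closed. *)
Definition valuation (R : realType) (n : nat) (V : set 'rV[R]_n -> R) : Prop :=
  forall K L : set 'rV[R]_n,
    convex_body K -> convex_body L -> convex_body (K `|` L) ->
    V (K `|` L) + V (K `&` L) = V K + V L.

Definition translation_invariant (R : realType) (n : nat)
    (V : set 'rV[R]_n -> R) : Prop :=
  forall (K : set 'rV[R]_n) (x : 'rV[R]_n),
    convex_body K -> V [set y + x | y in K] = V K.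

Definition bounded_on_ball (R : realType) (n : nat)
    (V : set 'rV[R]_n -> R) : Prop :=
  has_ubound [set `|V K| | K in
    [set K | convex_body K /\ K `<=` @euclidean_ball R n]].

(* The degree m is an arbitrary real number. The power 0 ^ m is defined only
   for m >= 0 (with 0 ^ 0 = 1, as for powR), so that for m < 0 nothing is
   required at l = 0, where powR would return 0. *)
Definition homogeneous (R : realType) (n : nat) (m : R)
    (V : set 'rV[R]_n -> R) : Prop :=
  forall (l : R) (K : set 'rV[R]_n),
    0 <= l -> (l = 0 -> 0 <= m) -> convex_body K ->
    V [set l *: y | y in K] = l `^ m * V K.

(* The zero map is homogeneous of every degree. *)
Definition nonzero_on_bodies (R : realType) (n : nat)
    (V : set 'rV[R]_n -> R) : Prop :=
  exists2 K : set 'rV[R]_n, convex_body K & V K != 0.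

(* Main.v *)
Require Import Defs.
From HB Require Import structures.
From mathcomp Require Import all_boot all_order all_algebra.
From mathcomp Require Import all_classical all_reals all_analysis.
From mathcomp Require Import measurable_realfun.
From mathcomp Require Import ring lra zify.

(** Why the degrees are restricted. The degree of [V] is the order of growth of
    [V (N K)]. Cut [N K] along the hyperplanes of the integer grid: additivity
    writes [V (N K)] as a sum over grid cells, taken half open so that no face
    counts twice. By translation invariance the cells inside [N K] all contribute
    the same number [w]. Each cell that meets [N K] without lying in it contributes
    a bounded amount, and convexity allows only [O(N^(n-1))] such cells
    ([card_boundary_cells]), so that ([cell_count_estimate])

      [N^m V(K) = w * (number of cells inside N K) + O(N^(n-1))].

    If [w = 0], this forces [m <= n - 1]. If [w <> 0], the unit cube, whose
    dilate contains of the order of [N^n] cells, forces [m = n]. A negative degree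
    contradicts boundedness, as small copies of a body lie in the ball.

    Why all of them occur. Composition with coordinate projections carries a
    degree to higher dimensions ([realizable_degree_select]), and integration over
    parallel sections raises dimension and degree by one ([realizable_degreeS]).
    The constant 1 in dimension 0 thus yields all integer degrees up to the
    dimension, and it remains to find every degree [p] in ]0, 1[ in the plane.
    The value of a section depends on its height in an uncontrolled way, so the
    integral over the heights is a finitely additive one, defined on all
    bounded functions of bounded support and covariant under affine substitutions
    ([affine_integral_exists]); it is built from an invariant mean on the line.

    In the plane ([realizable_degree_plane]) the valuation is the mean of [g''^p],
    where [g] is the support function along the directions [(x, 1)], and [g''] is
    up to normalization the radius of curvature of the boundary. Translations add
    affine functions to [g], dilations multiply it, and concavity of the power
    gives boundedness. If [K `|` L] is convex, its support function and that of
    [K `&` L] are the maximum and the minimum of those of [K] and [L]. Instead of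
    [g''] one takes the rescaled error of the one-sided first order expansion over
    a distance [1 / k], and the limit of the means along an ultrafilter. Outside a
    countable set of slopes, and for large [k], these errors for the maximum and
    the minimum are those for the two functions up to order
    ([defect_eventually0]), which gives additivity in the limit. *)


Set Implicit Arguments.
Unset Strict Implicit.
Unset Printing Implicit Defensive.

Import Order.TTheory GRing.Theory Num.Theory.
Import numFieldNormedType.Exports.

Local Open Scope classical_set_scope.
Local Open Scope ring_scope.

(** * Convex bodies *)

Section ConvexBodies.
Context {R : realType}.

Lemma convex_setP n (K : set 'rV[R]_n) :
  convex_set K <-> forall x y (t : R), K x -> K y -> 0 <= t <= 1 ->
    K (t *: x + (1 - t) *: y).
Proof.
split=> [cK x y t Kx Ky /andP[t0 t1]|cK x y l].
  have := cK x y (Itv01 t0 t1) (mem_set Kx) (mem_set Ky).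
  by rewrite inE.
rewrite !inE => Kx Ky.
have := cK x y l%:num Kx Ky; apply.
by rewrite ge0 le1.
Qed.

Lemma rV_continuous (T : topologicalType) n (f : T -> 'rV[R]_n) :
  (forall i, continuous (fun x => f x ord0 i)) -> continuous f.
Proof.
move=> cf x A /= /nbhs_ballP[e e0 eA].
have h : \forall y \near x, forall i : 'I_n, ball (f x ord0 i) e (f y ord0 i).
  apply: filter_forall => i.
  exact: (cf i x (ball (f x ord0 i) e) (nbhsx_ballx _ _ e0)).
apply: filterS h => y h; apply: eA; split => // i j.
by rewrite (ord1 i); exact: h.
Qed.

Lemma rV_scale_continuous n (l : R) : continuous (fun x : 'rV[R]_n => l *: x).
Proof.
apply: rV_continuous => i.
rewrite [X in continuous X](_ : _ = fun x : 'rV[R]_n => l * x ord0 i); last first.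
  by apply/funext => x; rewrite mxE.
move=> x; apply: (cvgM (cvg_cst _) (@coord_continuous _ _ _ _ _ x)).
Qed.

(** A segment is connected, so two closed sets that cover it and contain one end
    point each have a common point on it. *)
Lemma segment_meet n (K L : set 'rV[R]_n) (a b : 'rV[R]_n) :
  closed K -> closed L -> K a -> L b ->
  (forall t : R, 0 <= t <= 1 -> (K `|` L) (t *: a + (1 - t) *: b)) ->
  exists2 t : R, 0 <= t <= 1 & (K `&` L) (t *: a + (1 - t) *: b).
Proof.
move=> cK cL Ka Lb KL; set z := fun t : R => t *: a + (1 - t) *: b.
have cz : continuous z.
  apply: rV_continuous => i.
  rewrite [X in continuous X](_ : _ = fun t => t * a ord0 i + (1 - t) * b ord0 i);
    last by apply/funext => t; rewrite !mxE.
  move=> t; apply: cvgD; apply: cvgM; try exact: cvg_cst; first exact: cvg_id.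
  by apply: cvgB; [exact: cvg_cst|exact: cvg_id].
apply: contrapT => H.
have H' t : 0 <= t <= 1 -> ~ (K (z t) /\ L (z t)).
  by move=> t01 [? ?]; apply: H; exists t.
have z1 : z 1 = a by rewrite /z subrr scale0r addr0 scale1r.
have z0 : z 0 = b by rewrite /z subr0 scale0r add0r scale1r.
have h0 : 0 <= (0:R) <= 1 by rewrite lexx ler01.
have h1 : 0 <= (1:R) <= 1 by rewrite lexx ler01.
have E : `[0, 1]%classic `&` z @^-1` K = `[0, 1]%classic.
  apply: segment_connected.
  - by exists 1; split => /=; rewrite ?in_itv//= z1.
  - exists (~` (z @^-1` L)).
      by apply: closed_openC; apply: closed_comp => // t _; exact: cz.
    rewrite eqEsubset; split => t [] /= t01.
      by rewrite in_itv/= in t01 => Kt; split => //= Lt; exact: (H' t t01).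
    rewrite in_itv/= in t01 => nL; split => //=.
    by have [] := KL t t01.
  - exists (z @^-1` K) => //.
    by apply: closed_comp => // t _; exact: cz.
have : `[0, 1]%classic (0 : R) by rewrite /= in_itv.
rewrite -E => -[_ /=]; rewrite z0 => Kb.
by apply: (H' 0 h0); rewrite z0.
Qed.


Lemma rV_hausdorff n : hausdorff_space 'rV[R]_n.
Proof.
move=> p q pq; apply/rowP => i; apply: (@Rhausdorff R) => A B Ap Bq.
pose f := fun x : 'rV[R]_n => x ord0 i.
have cf : continuous f by exact: coord_continuous.
have [z [Az Bz]] := pq _ _ (cf p A Ap) (cf q B Bq).
by exists (f z).
Qed.

(** Convex bodies or the empty set: unlike bodies, these are stable under
    intersection with closed convex sets. *)
Definition convex_compact n (K : set 'rV[R]_n) :=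
  (forall x y (t : R), K x -> K y -> 0 <= t <= 1 ->
    K (t *: x + (1 - t) *: y)) /\ compact K.

Lemma convex_bodyE n (K : set 'rV[R]_n) :
  convex_body K <-> convex_compact K /\ K !=set0.
Proof.
by split=> [[/convex_setP cK kK K0]|[[/convex_setP cK kK] K0]]; split.
Qed.

Lemma convex_compact_closed n (K : set 'rV[R]_n) : convex_compact K -> closed K.
Proof. by move=> [_ /compact_closed]; apply; exact: rV_hausdorff. Qed.

Lemma convex_compactI n (K H : set 'rV[R]_n) : convex_compact K -> closed H ->
  (forall x y (t : R), H x -> H y -> 0 <= t <= 1 ->
    H (t *: x + (1 - t) *: y)) ->
  convex_compact (K `&` H).
Proof.
move=> [cK kK] clH cH; split; last exact: compact_closedI.
by move=> x y t [Kx Hx] [Ky Hy] t01; split; [exact: cK|exact: cH].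
Qed.

Lemma convex_compact_image n k (K : set 'rV[R]_n) (f : 'rV[R]_n -> 'rV[R]_k) :
  continuous f ->
  (forall x y (t : R), f (t *: x + (1 - t) *: y) = t *: f x + (1 - t) *: f y) ->
  convex_compact K -> convex_compact (f @` K).
Proof.
move=> cf af [cK kK]; split.
  move=> _ _ t [x Kx <-] [y Ky <-] t01.
  by rewrite -af; exists (t *: x + (1 - t) *: y) => //; exact: cK.
by apply: continuous_compact => //; exact: continuous_subspaceT.
Qed.

Lemma convex_body_image n k (K : set 'rV[R]_n) (f : 'rV[R]_n -> 'rV[R]_k) :
  continuous f ->
  (forall x y (t : R), f (t *: x + (1 - t) *: y) = t *: f x + (1 - t) *: f y) ->
  convex_body K -> convex_body (f @` K).
Proof.
move=> cf af /convex_bodyE[cK [x Kx]]; apply/convex_bodyE; split.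
  exact: convex_compact_image.
by exists (f x), x.
Qed.

Lemma shift_affine n (v x y : 'rV[R]_n) (t : R) :
  t *: x + (1 - t) *: y + v = t *: (x + v) + (1 - t) *: (y + v).
Proof. by apply/rowP => i; rewrite !mxE; ring. Qed.

Lemma rV_shift_continuous n (v : 'rV[R]_n) : continuous (fun x : 'rV[R]_n => x + v).
Proof.
apply: rV_continuous => i.
rewrite [X in continuous X](_ : _ = fun x : 'rV[R]_n => x ord0 i + v ord0 i);
  last by apply/funext => x; rewrite mxE.
by move=> x; exact: (cvgD (@coord_continuous _ _ _ _ _ x) (cvg_cst _)).
Qed.

Lemma scale_affine n (l : R) (x y : 'rV[R]_n) (t : R) :
  l *: (t *: x + (1 - t) *: y) = t *: (l *: x) + (1 - t) *: (l *: y).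
Proof. by apply/rowP => i; rewrite !mxE; ring. Qed.

Lemma convex_compact_shift n (K : set 'rV[R]_n) v :
  convex_compact K -> convex_compact [set y + v | y in K].
Proof.
apply: convex_compact_image; first exact: rV_shift_continuous.
by move=> x y t; exact: shift_affine.
Qed.

Lemma convex_body_shift n (K : set 'rV[R]_n) v :
  convex_body K -> convex_body [set y + v | y in K].
Proof.
apply: convex_body_image; first exact: rV_shift_continuous.
by move=> x y t; exact: shift_affine.
Qed.

Lemma convex_body_scale n (K : set 'rV[R]_n) l :
  convex_body K -> convex_body [set l *: y | y in K].
Proof.
apply: convex_body_image; first exact: rV_scale_continuous.
by move=> x y t; exact: scale_affine.
Qed.

Lemma euclidean_ball_coord n (x : 'rV[R]_n) i :
  euclidean_ball x -> `|x ord0 i| <= 1.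
Proof.
rewrite /euclidean_ball/= /euclidean_norm => h.
have h2 : \sum_(j < n) x ord0 j ^+ 2 <= 1.
  rewrite -(sqr_sqrtr (sumr_ge0 _ (fun j _ => sqr_ge0 (x ord0 j)))).
  by rewrite -(expr1n _ 2) lerXn2r ?nnegrE ?sqrtr_ge0.
rewrite -(@expr_le1 _ 2)// real_normK ?num_real//.
apply: le_trans h2; rewrite (bigD1 i)//= lerDl sumr_ge0// => j _.
exact: sqr_ge0.
Qed.

Lemma coord_euclidean_ball n (x : 'rV[R]_n) (c : R) :
  0 <= c -> c *+ n <= 1 -> (forall i, `|x ord0 i| <= c) -> euclidean_ball x.
Proof.
move=> c0 cn xc; rewrite /euclidean_ball/= /euclidean_norm.
case: n => [|n] in x cn xc *; first by rewrite big_ord0 sqrtr0.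
have c1 : c <= 1 by apply: le_trans cn; rewrite mulrS lerDl mulrn_wge0.
rewrite -sqrtr1 ler_wsqrtr//; apply: le_trans cn.
rewrite -[X in _ *+ X]card_ord -sumr_const; apply: ler_sum => i _.
rewrite -real_normK ?num_real// expr2.
by apply: le_trans (xc i); rewrite ler_piMr// (le_trans (xc i)).
Qed.

Lemma compact_coord_bounded n (K : set 'rV[R]_n) : compact K ->
  exists2 r : nat, (0 < r)%N & forall x i, K x -> `|x ord0 i| <= r%:R.
Proof.
move=> kK.
have h i : exists r : nat, forall x, K x -> `|x ord0 i| <= r%:R.
  have : compact ((fun x : 'rV[R]_n => x ord0 i) @` K).
    apply: continuous_compact => //; apply: continuous_subspaceT.
    exact: coord_continuous.
  move=> /compact_bounded[M [_ /(_ (M + 1)) MK]].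
  exists (Num.truncn (M + 1)).+1 => x Kx.
  apply: le_trans (ltW (truncnS_gt _)); apply: MK; first by rewrite ltrDl.
  by exists x.
have [r rK] := choice h.
exists (\max_i r i).+1 => // x i Kx; rewrite (le_trans (rK i x Kx))//.
by rewrite ler_nat leqW// leq_bigmax.
Qed.

(** The difference to the nearest point of a closed convex set is the coefficient
    vector of a strictly separating linear form. *)
Lemma convex_compact_separation n (K : set 'rV[R]_n) (p : 'rV[R]_n) :
  convex_compact K -> ~ K p -> K !=set0 ->
  exists u : 'I_n -> R, forall y, K y ->
    \sum_i u i * y ord0 i < \sum_i u i * p ord0 i.
Proof.
move=> [cK kK] nKp K0.
pose f (y : 'rV[R]_n) := \sum_i (p ord0 i - y ord0 i) ^+ 2.
have cf : continuous f.
  apply: (continuous_big (op := +%R)) => [|i _ x]; first exact: add_continuous.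
  have h : continuous_at x (fun y : 'rV[R]_n => p ord0 i - y ord0 i).
    exact: (cvgB (cvg_cst _) (@coord_continuous _ _ _ _ _ x)).
  exact: (continuousM h h).
have [q /set_mem Kq qmin] := EVT_min_rV K0 kK (continuous_subspaceT cf).
exists (fun i => p ord0 i - q ord0 i) => y Ky.
set A := \sum_i (p ord0 i - q ord0 i) * (y ord0 i - q ord0 i).
set B := \sum_i (y ord0 i - q ord0 i) ^+ 2.
have B0 : 0 <= B by apply: sumr_ge0 => i _; exact: sqr_ge0.
have C0 : 0 < f q.
  rewrite lt_neqAle sumr_ge0 ?andbT => [|i _]; last exact: sqr_ge0.
  apply/negP => /eqP /esym /eqP; rewrite psumr_eq0 => [/allP h|i _]; last exact: sqr_ge0.
  apply: nKp; suff -> : p = q by [].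
  apply/rowP => i; apply/eqP; rewrite -subr_eq0 -(sqrf_eq0 (_ - _)).
  by have := h i; rewrite mem_index_enum => /(_ isT).
have key t : 0 <= t <= 1 -> 2 * t * A <= t ^+ 2 * B.
  move=> t01; have := qmin _ (mem_set (cK y q t Ky Kq t01)).
  have -> : f (t *: y + (1 - t) *: q) = f q + (t ^+ 2 * B - 2 * t * A).
    rewrite /A /B !mulr_sumr -sumrB -big_split/=; apply: eq_bigr => i _.
    by rewrite !mxE; ring.
  by lra.
suff AC : A < f q.
  rewrite -subr_gt0 -sumrB.
  have -> : \sum_i ((p ord0 i - q ord0 i) * p ord0 i -
                    (p ord0 i - q ord0 i) * y ord0 i) = f q - A.
    by rewrite /f /A -sumrB; apply: eq_bigr => i _; ring.
  by rewrite subr_gt0.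
rewrite ltNge; apply/negP => CA.
have A0 : 0 < A by exact: lt_le_trans CA.
have AB : 0 < A + B by lra.
(* Moving from [q] towards [y] by [t] changes the squared distance to [p] by
   [t ^ 2 * B - 2 * t * A], which is negative for this [t]. *)
set t := A / (A + B).
have t0 : 0 < t by rewrite divr_gt0.
have tAB : t * A + t * B = A by rewrite -mulrDr divfK// gt_eqF.
have tB : 0 <= t * B by rewrite mulr_ge0// ltW.
have t1 : t <= 1 by rewrite ler_pdivrMr// mul1r lerDl.
have := key t; rewrite (ltW t0) t1 => /(_ isT).
rewrite expr2 -mulrA (mulrCA 2) -mulrA ler_pM2l// => h.
have : 0 < t * A by rewrite mulr_gt0.
by lra.
Qed.

(** This is how convexity of a union enters every proof of additivity. *)
Lemma convexU_segment_meet n (K L : set 'rV[R]_n) (a b : 'rV[R]_n) :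
  convex_compact K -> convex_compact L -> convex_compact (K `|` L) ->
  K a -> L b ->
  exists2 t : R, 0 <= t <= 1 & (K `&` L) (t *: a + (1 - t) *: b).
Proof.
move=> cK cL [cKL _] Ka Lb; apply: segment_meet => //.
- exact: convex_compact_closed.
- exact: convex_compact_closed.
- by move=> t t01; apply: cKL => //; [left|right].
Qed.

Lemma convex_bodyI_of_convexU n (K L : set 'rV[R]_n) :
  convex_body K -> convex_body L -> convex_body (K `|` L) ->
  convex_body (K `&` L).
Proof.
move=> /convex_bodyE[cK [a Ka]] /convex_bodyE[cL [b Lb]] /convex_bodyE[cKL _].
apply/convex_bodyE; split.
  by apply: convex_compactI => //; [exact: convex_compact_closed|exact: cL.1].
have [t _ ?] := convexU_segment_meet cK cL cKL Ka Lb.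
by exists (t *: a + (1 - t) *: b).
Qed.

End ConvexBodies.

(** * Values on convex bodies and the empty set *)

Section ExtendByZero.
Context {R : realType}.

(** Cutting a body can leave an empty piece; with the value 0 there, additivity
    persists. *)
Definition extend0 n (V : set 'rV[R]_n -> R) (K : set 'rV[R]_n) : R :=
  if K == set0 then 0 else V K.

Lemma extend0_set0 n (V : set 'rV[R]_n -> R) : extend0 V set0 = 0.
Proof. by rewrite /extend0 eqxx. Qed.

Lemma extend0_neq0 n (V : set 'rV[R]_n -> R) K : K !=set0 -> extend0 V K = V K.
Proof. by move=> /set0P; rewrite /extend0 => /negbTE ->. Qed.

Lemma extend0_valuation n (V : set 'rV[R]_n -> R) (K L : set 'rV[R]_n) :
  valuation V -> convex_compact K -> convex_compact L ->
  convex_compact (K `|` L) ->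
  extend0 V (K `|` L) + extend0 V (K `&` L) = extend0 V K + extend0 V L.
Proof.
move=> vV cK cL cKL.
have [->|K0] := eqVneq K set0; first by rewrite set0U set0I !extend0_set0 addrC.
have [->|L0] := eqVneq L set0; first by rewrite setU0 setI0 !extend0_set0.
move: K0 L0 => /set0P K0 /set0P L0.
have bK : convex_body K by apply/convex_bodyE.
have bL : convex_body L by apply/convex_bodyE.
have KL0 : (K `|` L) !=set0 by case: K0 => x Kx; exists x; left.
have bKL : convex_body (K `|` L) by apply/convex_bodyE.
have /convex_bodyE[_ I0] := convex_bodyI_of_convexU bK bL bKL.
by rewrite !extend0_neq0// vV.
Qed.

Lemma extend0_shift n (V : set 'rV[R]_n -> R) (K : set 'rV[R]_n) v :
  translation_invariant V -> convex_compact K ->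
  extend0 V [set y + v | y in K] = extend0 V K.
Proof.
move=> tV cK; have [->|/set0P K0] := eqVneq K set0.
  by rewrite image_set0 extend0_set0.
have K0' : [set y + v | y in K] !=set0 by case: K0 => x Kx; exists (x + v), x.
by rewrite !extend0_neq0// tV//; apply/convex_bodyE.
Qed.

Lemma bounded_on_ballE n (V : set 'rV[R]_n -> R) : bounded_on_ball V ->
  exists2 c : R, 0 <= c &
  forall K, convex_body K -> K `<=` @euclidean_ball R n -> `|V K| <= c.
Proof.
move=> [c cP]; exists (Num.max 0 c); first by rewrite le_max lexx.
by move=> K bK sK; rewrite le_max cP ?orbT//; exists K.
Qed.

Lemma extend0_scale n (V : set 'rV[R]_n -> R) m (K : set 'rV[R]_n) l :
  homogeneous m V -> 0 < l -> convex_compact K ->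
  extend0 V [set l *: y | y in K] = l `^ m * extend0 V K.
Proof.
move=> hV l0 cK; have [->|/set0P K0] := eqVneq K set0.
  by rewrite image_set0 extend0_set0 mulr0.
have K0' : [set l *: y | y in K] !=set0 by case: K0 => x Kx; exists (l *: x), x.
rewrite !extend0_neq0//; apply: hV; first exact: ltW.
  by move=> l0'; move: l0; rewrite l0' ltxx.
exact/convex_bodyE.
Qed.

(** Homogeneity carries the bound from the ball to larger boxes. *)
Lemma extend0_bounded n (V : set 'rV[R]_n -> R) m (r : nat) :
  homogeneous m V -> bounded_on_ball V ->
  exists2 c, 0 <= c & forall K : set 'rV[R]_n, convex_compact K ->
    (forall x i, K x -> `|x ord0 i| <= r%:R) -> `|extend0 V K| <= c.
Proof.
move=> hV bV; have [c c0 cP] := bounded_on_ballE bV.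
pose l : R := (r.+1%:R * n.+1%:R)^-1.
have l0 : 0 < l by rewrite invr_gt0 mulr_gt0 ?ltr0n.
exists (l `^ (- m) * c); first by rewrite mulr_ge0 ?powR_ge0.
move=> K cK rK; rewrite powRN ler_pdivlMl ?powR_gt0//.
rewrite -[X in X * _]ger0_norm ?powR_ge0// -normrM -(extend0_scale hV)//.
have [->|/set0P K0] := eqVneq K set0.
  by rewrite image_set0 extend0_set0 normr0.
have K0' : [set l *: y | y in K] !=set0 by case: K0 => x Kx; exists (l *: x), x.
rewrite extend0_neq0//; apply: cP; first by apply/convex_body_scale/convex_bodyE.
move=> _ [y Ky <-]; apply: (@coord_euclidean_ball _ _ _ n.+1%:R^-1) => //.
  by rewrite -[_ *+ n]mulr_natr ler_pdivrMl ?mulr1 ?ler_nat// ltr0n.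
move=> i; rewrite mxE normrM gtr0_norm// /l invfM mulrC mulrA ger_pMl ?invr_gt0 ?ltr0n//.
rewrite ler_pdivrMr ?ltr0n// mul1r (le_trans (rK y i Ky))// ler_nat.
exact: leqnSn.
Qed.

End ExtendByZero.

(** * Decomposition into grid cells *)

Section Cells.
Context {R : realType}.

Variables (n : nat) (V : set 'rV[R]_n -> R).
Hypothesis vV : valuation V.
Local Notation Vo := (extend0 V).

(** The coordinate is a natural number in order to recurse along the coordinates;
    for [i >= n] the slab is the whole space. *)
Definition slab (i : nat) (a b : R) : set 'rV[R]_n :=
  [set x | forall j : 'I_n, j = i :> nat -> a <= x ord0 j <= b].

Lemma convex_compact_slab K i a b :
  convex_compact K -> convex_compact (K `&` slab i a b).
Proof.
move=> cK; apply: convex_compactI => //.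
  have -> : slab i a b = \bigcap_(j in [set j : 'I_n | j = i :> nat])
      ((fun x : 'rV[R]_n => x ord0 j) @^-1` `[a, b]).
    by apply/seteqP; split => x h j /= ji; have := h j ji; rewrite /= in_itv.
  apply: closed_bigI => j _; apply: closed_comp; last exact: interval_closed.
  by move=> x _; exact: coord_continuous.
move=> x y t hx hy /andP[t0 t1] j ji; rewrite !mxE.
have /andP[? ?] := hx j ji; have /andP[? ?] := hy j ji.
by apply/andP; split; nra.
Qed.

Lemma slab_cut K i a b c : convex_compact K -> a <= b -> b <= c ->
  Vo (K `&` slab i a c) = Vo (K `&` slab i a b) + Vo (K `&` slab i b c)
    - Vo (K `&` slab i b b).
Proof.
move=> cK ab bc.
have E : (K `&` slab i a b) `|` (K `&` slab i b c) = K `&` slab i a c.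
  rewrite -setIUr; congr (_ `&` _); apply/seteqP; split => x /=.
    case=> h j ji; have /andP[h1 h2] := h j ji.
      by rewrite h1 (le_trans h2).
    by rewrite h2 (le_trans ab).
  move=> h; have [Hi|Hi] := ltnP i n; last first.
    by left => j ji; move: (ltn_ord j); rewrite ji ltnNge Hi.
  pose k := Ordinal Hi; have /andP[h1 h2] := h k erefl.
  have [xb|bx] := leP (x ord0 k) b.
    by left => j ji; have -> : j = k by [apply: val_inj]; rewrite h1 xb.
  by right => j ji; have -> : j = k by [apply: val_inj]; rewrite h2 ltW.
have F : (K `&` slab i a b) `&` (K `&` slab i b c) = K `&` slab i b b.
  rewrite setIACA setIid; congr (_ `&` _); apply/seteqP; split => x /=.
    by move=> [h1 h2] j ji; have /andP[_ ->] := h1 j ji; have /andP[-> _] := h2 j ji.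
  by move=> h; split => j ji; have /andP[h1 h2] := h j ji;
    rewrite ?h1 ?h2 (le_trans ab, le_trans h2).
have := extend0_valuation vV (convex_compact_slab i a b cK)
  (convex_compact_slab i b c cK).
rewrite E F => /(_ (convex_compact_slab i a c cK)) <-.
by rewrite addrK.
Qed.

(** The value on the part of [K] in the grid cell with lower corner [t], without the
    upper faces of the cell. That part is not compact; its value is the alternating
    sum of the values on its closed faces. *)
Fixpoint cell_value (i : nat) (t : seq nat) (K : set 'rV[R]_n) : R :=
  if t is a :: t' then
    cell_value i.+1 t' (K `&` slab i a%:R a.+1%:R) -
    cell_value i.+1 t' (K `&` slab i a.+1%:R a.+1%:R)
  else Vo K.

Fixpoint cube (i : nat) (t : seq nat) : set 'rV[R]_n :=
  if t is a :: t' then slab i a%:R a.+1%:R `&` cube i.+1 t' else setT.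

(** The slabs without their upper faces tile the space, and the uppermost face
    misses [K]. *)
Lemma slab_sum K i (M : nat) : convex_compact K -> (i < n)%N ->
  (forall x j, K x -> 0 <= x ord0 j < M%:R) ->
  Vo K = \sum_(a < M) (Vo (K `&` slab i a%:R a.+1%:R) -
                       Vo (K `&` slab i a.+1%:R a.+1%:R)).
Proof.
move=> cK lin KM.
have H b : Vo (K `&` slab i 0 b%:R) - Vo (K `&` slab i b%:R b%:R) =
    \sum_(a < b) (Vo (K `&` slab i a%:R a.+1%:R) -
                       Vo (K `&` slab i a.+1%:R a.+1%:R)).
  elim: b => [|b IH]; first by rewrite big_ord0 subrr.
  rewrite big_ord_recr/= -IH (@slab_cut _ i 0 b%:R b.+1%:R)//; last first.
    by rewrite ler_nat.
  ring.
rewrite -H.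
have -> : K `&` slab i 0 M%:R = K.
  apply: setIidl => x Kx j _; have /andP[-> /ltW ->] := KM x j Kx.
  by [].
have -> : K `&` slab i M%:R M%:R = set0.
  rewrite -subset0 => x [Kx /(_ (Ordinal lin) erefl)].
  by have /andP[_ h1] := KM x (Ordinal lin) Kx; rewrite leNgt h1.
by rewrite extend0_set0 subr0.
Qed.

Lemma big_tuple_cons (T : finType) k (f : seq T -> R) :
  \sum_(t : k.+1.-tuple T) f t = \sum_(a : T) \sum_(t : k.-tuple T) f (a :: t).
Proof.
rewrite pair_big/= (reindex (fun p : T * k.-tuple T => [tuple of p.1 :: p.2])).
  by apply: eq_bigr => -[a t].
exists (fun t : k.+1.-tuple T => (thead t, behead_tuple t)).
  by move=> [a t] _ /=; congr pair; apply: val_inj.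
by move=> t _; rewrite [RHS]tuple_eta.
Qed.

Lemma cell_sum k i K M : (i + k <= n)%N -> convex_compact K ->
  (forall x j, K x -> 0 <= x ord0 j < M%:R) ->
  Vo K = \sum_(t : k.-tuple 'I_M) cell_value i (map val t) K.
Proof.
elim: k => [|k IH] in i K *.
  move=> _ _ _; rewrite (big_pred1 [tuple])//= => t.
  by apply/esym/eqP/val_inj/size0nil; rewrite size_tuple.
move=> ikn cK KM; rewrite (@slab_sum K i M)//; last by lia.
rewrite (@big_tuple_cons _ k (fun t => cell_value i (map val t) K)).
apply: eq_bigr => a _ /=.
have H b c : Vo (K `&` slab i b c) =
    \sum_(t : k.-tuple 'I_M) cell_value i.+1 (map val t) (K `&` slab i b c).
  apply: IH; first by lia.
    exact: convex_compact_slab.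
  by move=> x j [Kx _]; exact: KM.
by rewrite !H -sumrB.
Qed.

(** Hence a cell inside [K] contributes an amount that does not depend on [K]. *)
Lemma cell_value_local i t K :
  cell_value i t K = cell_value i t (K `&` cube i t).
Proof.
elim: t => [|a t IH] in i K *; first by rewrite /= setIT.
rewrite /= [X in X - _]IH [X in _ - X]IH [X in _ = X - _]IH [X in _ = _ - X]IH.
congr (cell_value _ _ _ - cell_value _ _ _); apply/seteqP; split => x /=.
- by move=> [[? ?] ?].
- by move=> [[[? [? ?]] ?] ?].
- move=> [[? h] ?]; do !split => //; move=> j ji; have /andP[h1 h2] := h j ji.
  by rewrite h2 (le_trans _ h1)// ler_nat.
- by move=> [[[? [? ?]] ?] ?].
Qed.

(** Each coordinate doubles the number of faces involved. With [c = 0], this also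
    shows that cells missing [K] contribute nothing. *)
Lemma cell_value_bound i t K c : convex_compact K ->
  (forall K', convex_compact K' -> K' `<=` K `&` cube i t -> `|Vo K'| <= c) ->
  `|cell_value i t K| <= 2 ^+ size t * c.
Proof.
elim: t => [|a t IH] in i K *.
  by move=> cK h; rewrite /= mul1r; apply: h => //; rewrite setIT.
move=> cK h /=; rewrite exprS -mulrA mulr_natl mulr2n.
apply: le_trans (ler_normB _ _) _; apply: lerD; apply: IH => //;
  try exact: convex_compact_slab.
  by move=> K' cK' sK'; apply: h => // x /sK'[[? ?] ?].
move=> K' cK' sK'; apply: h => // x /sK'[[? h1] ?]; do !split => //.
move=> j ji; have /andP[h2 h3] := h1 j ji.
by rewrite h3 (le_trans _ h2)// ler_nat.
Qed.

Lemma slab_shift K i a b (v : 'rV[R]_n) (c : R) :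
  (forall j : 'I_n, j = i :> nat -> v ord0 j = c) ->
  [set y + v | y in K] `&` slab i (a + c) (b + c) =
  [set y + v | y in K `&` slab i a b].
Proof.
move=> vc; apply/seteqP; split => x.
  move=> [[y Ky <-] h]; exists y => //; split => // j ji.
  by have := h j ji; rewrite mxE (vc j ji) !lerD2r.
move=> [y [Ky h] <-]; split; first by exists y.
by move=> j ji; rewrite mxE (vc j ji) !lerD2r; exact: h.
Qed.

Lemma cell_value_shift i t K (v : 'rV[R]_n) :
  translation_invariant V -> convex_compact K ->
  (forall (j : 'I_n) l, (l < size t)%N -> j = (i + l)%N :> nat ->
     v ord0 j = (nth 0%N t l)%:R) ->
  cell_value i t [set y + v | y in K] = cell_value i (nseq (size t) 0%N) K.
Proof.
move=> tV; elim: t => [|a t IH] in i K *.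
  by move=> cK _ /=; exact: extend0_shift.
move=> cK vt /=.
have vc (j : 'I_n) : j = i :> nat -> v ord0 j = a%:R.
  by move=> ji; apply: (vt j 0%N) => //; rewrite addn0.
have vt' (j : 'I_n) l : (l < size t)%N -> j = (i.+1 + l)%N :> nat ->
     v ord0 j = (nth 0%N t l)%:R.
  by move=> lt ji; apply: (vt j l.+1) => //; rewrite ji addSnnS.
have := slab_shift K 0 1 vc; have := slab_shift K 1 1 vc.
rewrite add0r -[1 + _]/(1%:R + a%:R) -natrD add1n => -> ->.
by rewrite !IH//; exact: convex_compact_slab.
Qed.

Lemma cubeP i t x : cube i t x <-> forall (j : 'I_n) l, (l < size t)%N ->
  j = (i + l)%N :> nat -> (nth 0%N t l)%:R <= x ord0 j <= (nth 0%N t l).+1%:R.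
Proof.
elim: t => [|a t IH] in i *; first by split.
split=> /= [[h /IH h2] j [|l] lt ji|h].
- by apply: h; rewrite ji addn0.
- by apply: h2 => //; rewrite ji addSnnS.
- split=> [j ji|]; first by apply: (h j 0%N) => //; rewrite addn0.
  by apply/IH => j l lt ji; apply: (h j l.+1) => //; rewrite ji addSnnS.
Qed.

End Cells.

(** * Counting boundary cells *)

Section BoundaryCells.
Context {R : realType}.
Variables (n M : nat) (K : set 'rV[R]_n).
Hypothesis cK : convex_compact K.

Local Notation cube_of t := (@cube R n 0 (map val t)).

Definition meets (t : n.-tuple 'I_M) : bool := `[< K `&` cube_of t !=set0 >].
Definition inside (t : n.-tuple 'I_M) : bool := `[< cube_of t `<=` K >].
Definition boundary_cells := [set t | meets t && ~~ inside t]%SET.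

Lemma cube_tupleP (t : n.-tuple 'I_M) x : cube_of t x <->
  forall j, (tnth t j)%:R <= x ord0 j <= (tnth t j).+1%:R.
Proof.
have E (j : 'I_n) : nth 0%N (map val t) j = tnth t j.
  by rewrite (nth_map (tnth t j)) ?size_tuple// -tnth_nth.
split=> [/cubeP h j|h].
  by have := h j j; rewrite size_map size_tuple E; apply.
by apply/cubeP => j l _; rewrite add0n => <-; rewrite E; exact: h.
Qed.

Definition replace_coord (i : 'I_n) (a : 'I_M) (t : n.-tuple 'I_M) :=
  [tuple if j == i then a else tnth t j | j < n].

(** [s] chooses the side of the cell, on the line of cells in direction [i], where no
    cell at distance [n] or more meets [K]. *)
Definition extreme_cells (i : 'I_n) (s : bool) :=
  [set t | meets t & [forall a : 'I_M,
    (if s then tnth t i + n <= a else a + n <= tnth t i)%N ==>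
    ~~ meets (replace_coord i a t)]]%SET.

Lemma modn_gap (a b : nat) : a = b %[mod n] -> (a < b)%N -> (a + n <= b)%N.
Proof.
move=> /esym/eqP + ab; rewrite (eqn_mod_dvd _ (ltnW ab)) => /dvdn_leq.
by rewrite subn_gt0 ab => /(_ isT); rewrite leq_subRL ?(ltnW ab).
Qed.

(** Two extreme cells on one line are less than [n] apart, so an extreme cell is
    known from its line and its position modulo [n]. Hence the map that sends an
    extreme cell and a new [i]-th coordinate to the old position modulo [n] and the
    moved cell is injective. *)
Lemma card_extreme_cells i s :
  (#|extreme_cells i s| * M <= n * M ^ n)%N.
Proof.
have n0 : (0 < n)%N by exact: leq_ltn_trans (ltn_ord i).
pose f (p : n.-tuple 'I_M * 'I_M) : 'I_n * n.-tuple 'I_M :=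
  (Ordinal (ltn_pmod (tnth p.1 i) n0), replace_coord i p.2 p.1).
have inj : {in finset.setX (extreme_cells i s) [set: 'I_M]%SET &, injective f}.
  move=> [t a] [t' a']; rewrite !inE/= !andbT.
  move=> /andP[mt /forallP Et] /andP[mt' /forallP Et'].
  move=> H; have tt' := congr1 (fun q => val q.1) H.
  have E j := congr1 (fun q => tnth q.2 j) H; move: tt' => /= tt'.
  have Ei := E i; rewrite !tnth_mktuple eqxx in Ei.
  have Ej j : j != i -> tnth t j = tnth t' j.
    by move=> ji; have := E j; rewrite !tnth_mktuple (negbTE ji).
  have rep (u u' : n.-tuple 'I_M) : (forall j, j != i -> tnth u j = tnth u' j) ->
     replace_coord i (tnth u' i) u = u'.
    move=> h; apply: eq_from_tnth => j; rewrite tnth_mktuple.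
    by case: eqVneq => [->//|]; exact: h.
  suff Ett : tnth t i = tnth t' i.
    congr pair => //; apply: eq_from_tnth => j.
    by have [->//|] := eqVneq j i; exact: Ej.
  apply: val_inj => /=; apply/eqP; move: tt'.
  have [lt|lt|//] := ltngtP (tnth t i) (tnth t' i) => tt'.
  - have h : (tnth t i + n <= tnth t' i)%N by exact: modn_gap.
    case: s Et Et' => Et Et'.
      have := Et (tnth t' i); rewrite h/= rep//.
      by rewrite mt'.
    have := Et' (tnth t i); rewrite h/= rep; last by move=> j /Ej.
    by rewrite mt.
  - have h : (tnth t' i + n <= tnth t i)%N by exact: modn_gap.
    case: s Et Et' => Et Et'.
      have := Et' (tnth t i); rewrite h/= rep; last by move=> j /Ej.
      by rewrite mt.
    have := Et (tnth t' i); rewrite h/= rep//.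
    by rewrite mt'.
have := max_card (mem (f @: finset.setX (extreme_cells i s) [set: 'I_M]%SET)).
by rewrite card_in_imset// cardsX cardsT card_prod card_tuple !card_ord.
Qed.

(** Separate a point [p] of the cell outside [K] from [K] by a linear form [u], and
    let [i] maximize [`|u i|]. Moving the cell by [n] or more along [i], on the side
    given by the sign of [u i], gains at least [(n - 1) * `|u i|] over [p], and this
    is the most that the other [n - 1] coordinates can lose. *)
Lemma boundary_cells_extreme :
  boundary_cells \subset (\bigcup_(p : 'I_n * bool) extreme_cells p.1 p.2)%SET.
Proof.
apply/fintype.subsetP => t; rewrite inE => /andP[mt /asboolPn nt].
have [p [tp nKp]] : exists p, cube_of t p /\ ~ K p.
  by apply: contrapT => h; apply: nt => x tx; apply: contrapT => nKx; apply: h; exists x.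
have /asboolP[x0 [Kx0 tx0]] := mt.
have K0 : K !=set0 by exists x0.
have [u up] := convex_compact_separation cK nKp K0.
have [n0|n0] := posnP n.
  have noI (j : 'I_n) : False by have := leq_trans (ltn_ord j) (eq_leq n0).
  by exfalso; have := up x0 Kx0; rewrite !big1 ?ltxx// => j; have := noI j.
pose i0 := Ordinal n0.
pose i := [arg max_(i > i0) `|u i|]%O.
have umax j : `|u j| <= `|u i| by rewrite /i; case: arg_maxP => // k _ /(_ j); apply.
apply/bigcupP; exists (i, 0 <= u i) => //=.
rewrite inE mt/=; apply/forallP => a; apply/implyP => ha; apply/asboolPn.
move=> [y [Ky /cube_tupleP ty]].
have := up y Ky; apply/negP; rewrite -leNgt -subr_ge0 -sumrB.
have tp' := (cube_tupleP t p).1 tp.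
have yi := ty i; rewrite tnth_mktuple eqxx in yi.
have pi := tp' i.
have yj j : j != i -> `|y ord0 j - p ord0 j| <= 1.
  move=> ji; have := ty j; rewrite tnth_mktuple (negbTE ji) => /andP[y1 y2].
  have /andP[p1 p2] := tp' j; rewrite ler_norml.
  by move: y2 p2; rewrite -natr1 => y2 p2; apply/andP; split; lra.
rewrite (bigD1 i)//=.
have -> : forall A B : R, 0 <= A + B = (- B <= A) by move=> A B; rewrite -lerBlDr sub0r.
have H1 : - (\sum_(j < n | j != i) (u j * y ord0 j - u j * p ord0 j)) <=
   \sum_(j < n | j != i) `|u i|.
  rewrite -sumrN; apply: ler_sum => j ji; rewrite -mulrBr.
  rewrite (le_trans (ler_norm _))// normrN normrM -[leRHS]mulr1.
  by apply: ler_pM => //; exact: yj.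
apply: le_trans H1 _.
rewrite sumr_const cardC1 card_ord -mulrBr -[`|u i| *+ _]mulr_natr.
case: (lerP 0 (u i)) ha => ui ha; rewrite ?(ger0_norm ui) ?(ltr0_norm ui).
  apply: ler_wpM2l => //.
  have : ((tnth t i)%:R + n%:R : R) <= a%:R by rewrite -natrD ler_nat.
  have -> : (n%:R : R) = n.-1%:R + 1 by rewrite natr1 prednK.
  move: yi pi => /andP[y1 y2] /andP[p1 p2]; move: p2; rewrite -natr1 => p2.
  by lra.
have : (a%:R + n%:R : R) <= (tnth t i)%:R by rewrite -natrD ler_nat.
have -> : (n%:R : R) = n.-1%:R + 1 by rewrite natr1 prednK.
move: yi pi => /andP[y1 y2] /andP[p1 p2]; move: y2; rewrite -natr1 => y2 h.
by rewrite mulNr -mulrN; apply: ler_wnM2l; [exact: ltW|lra].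
Qed.

Lemma card_boundary_cells : (#|boundary_cells| * M <= 2 * n * n * M ^ n)%N.
Proof.
have H : (#|boundary_cells| <= \sum_(p : 'I_n * bool) #|extreme_cells p.1 p.2|)%N.
  apply: leq_trans (subset_leq_card boundary_cells_extreme) _.
  elim/big_rec2 : _ => [|p k B _ IH]; first by rewrite cards0.
  by rewrite (leq_trans (leq_card_setU _ _))// leq_add2l.
rewrite (leq_trans (leq_mul H (leqnn M)))// big_distrl/=.
have : (\sum_(p : 'I_n * bool) #|extreme_cells p.1 p.2| * M <=
    \sum_(p : 'I_n * bool) n * M ^ n)%N.
  by apply: leq_sum => p _; exact: card_extreme_cells.
by rewrite sum_nat_const card_prod card_ord card_bool mulnA (mulnC n 2).
Qed.

End BoundaryCells.

(** * The possible degrees *)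

Section Degrees.
Context {R : realType}.

Lemma powR_growth (a b r s : R) : 0 < a ->
  (forall N : nat, (0 < N)%N -> a * N%:R `^ r <= b * N%:R `^ s) -> r <= s.
Proof.
move=> a0 H; rewrite leNgt; apply/negP => sr.
have b0 : 0 < b.
  by have := H 1%N isT; rewrite !powR1 !mulr1; exact: lt_le_trans.
have g0 : 0 < r - s by rewrite subr_gt0.
set y := (b / a) `^ (r - s)^-1.
pose N := (Num.truncn y).+1.
have yN : y < N%:R by exact: truncnS_gt.
have N0 : (0:R) < N%:R by rewrite ltr0n.
have := H N isT; apply/negP; rewrite -ltNge.
have -> : N%:R `^ r = N%:R `^ (r - s) * N%:R `^ s :> R.
  rewrite -powRD ?subrK//; apply/implyP => _; exact: lt0r_neq0.
rewrite mulrA ltr_pM2r ?powR_gt0// mulrC -ltr_pdivrMr//.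
have -> : b / a = y `^ (r - s).
  by rewrite /y -powRrM mulVf ?gt_eqF// powRr1// divr_ge0// ltW.
by rewrite gt0_ltr_powR// nnegrE ?powR_ge0.
Qed.

Variables (n : nat) (V : set 'rV[R]_n -> R) (m : R).
Hypotheses (vV : valuation V) (tV : translation_invariant V).
Hypotheses (bV : bounded_on_ball V) (hV : homogeneous m V).

(** With a negative degree, the values on small copies of a body would blow up. *)
Lemma degree_ge0 : nonzero_on_bodies V -> 0 <= m.
Proof.
move=> [K bK VK]; have [c c0 cP] := bounded_on_ballE bV.
have kK : compact K by case: bK.
have [r r0 rK] := compact_coord_bounded kK.
pose s : R := r%:R * n.+1%:R.
have s0 : 0 < s by rewrite mulr_gt0// ltr0n.
rewrite -oppr_le0; apply: (@powR_growth (s `^ (- m) * `|V K|) c).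
  by rewrite mulr_gt0 ?powR_gt0 ?normr_gt0.
move=> N N0; have N0' : (0:R) < N%:R by rewrite ltr0n.
rewrite powRr0 mulr1.
pose l := (s * N%:R)^-1.
have l0 : 0 < l by rewrite invr_gt0 mulr_gt0.
have E : V [set l *: y | y in K] = l `^ m * V K.
  by apply: hV => // [|l0']; [exact: ltW|move: l0; rewrite l0' ltxx].
have -> : s `^ (- m) * `|V K| * N%:R `^ (- m) = `|V [set l *: y | y in K]|.
  rewrite E normrM (ger0_norm (powR_ge0 _ _)) mulrAC -powRM ?ltW//.
  have -> : l = (s * N%:R) `^ (- 1) by rewrite powR_inv1// mulr_ge0 ?ltW.
  by rewrite -powRrM mulN1r.
apply: cP; first exact: convex_body_scale.
move=> _ [y Ky <-]; apply: (@coord_euclidean_ball _ _ _ n.+1%:R^-1) => //.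
  by rewrite -[_ *+ n]mulr_natr ler_pdivrMl ?mulr1 ?ler_nat// ltr0n.
move=> i; rewrite mxE normrM gtr0_norm//.
have hy := rK y i Ky.
apply: (@le_trans _ _ (l * r%:R)); first by rewrite ler_pM2l.
have -> : l * r%:R = (n.+1%:R * N%:R)^-1.
  have n0 : (n%:R + 1 : R) != 0 by rewrite natr1 pnatr_eq0.
  have r0' : (r%:R : R) != 0 by rewrite pnatr_eq0 -lt0n.
  by rewrite /l /s; field; rewrite r0' addrC n0 gt_eqF.
by rewrite lef_pV2 ?posrE ?mulr_gt0 ?ltr0n// ler_peMr// ler1n.
Qed.

(** Up to translation, all cells are one cube. *)
Lemma cell_piece_bound : exists2 c : R, 0 <= c &
  forall t K, size t = n -> convex_compact K -> K `<=` @cube R n 0 t ->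
    `|extend0 V K| <= c.
Proof.
have [c c0 cP] := extend0_bounded 1 hV bV; exists c => // t K st cK sK.
pose v : 'rV[R]_n := \row_j (nth 0%N t j)%:R.
rewrite -(extend0_shift (- v) tV cK).
apply: cP => [|_ i [y Ky <-]]; first exact: convex_compact_shift.
have /(cubeP _ _ _)/(_ i i) := sK _ Ky; rewrite st ltn_ord => /(_ isT erefl).
by rewrite !mxE -natr1 => /andP[h1 h2]; rewrite ler_norml; apply/andP; split; lra.
Qed.

Definition unit_cube : set 'rV[R]_n := @cube R n 0 (nseq n 0%N).
(** The common contribution of the cells inside a body. *)
Definition unit_cell := cell_value V 0 (nseq n 0%N) unit_cube.

Lemma unit_cubeP x : unit_cube x <-> forall j, 0 <= x ord0 j <= 1.
Proof.
rewrite /unit_cube; split=> [/cubeP h j|h].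
  by have := h j j; rewrite size_nseq nth_nseq ltn_ord => /(_ isT erefl).
by apply/cubeP => j l; rewrite size_nseq nth_nseq => ->.
Qed.

Lemma convex_body_unit_cube : convex_body unit_cube.
Proof.
apply/convex_bodyE; split; last first.
  by exists 0; apply/unit_cubeP => j; rewrite mxE lexx ler01.
split.
  move=> x y t /unit_cubeP hx /unit_cubeP hy /andP[t0 t1].
  apply/unit_cubeP => j; rewrite !mxE.
  by have /andP[? ?] := hx j; have /andP[? ?] := hy j; apply/andP; split; nra.
have -> : unit_cube = [set v : 'rV[R]_n | forall i, `[0:R, 1]%classic (v ord0 i)].
  by apply/seteqP; split => x /=; [move/unit_cubeP => h i; rewrite in_itv/= h|
    move=> h; apply/unit_cubeP => i; have := h i; rewrite in_itv].
exact: (@rV_compact R n (fun=> `[0, 1]%classic) (fun=> @segment_compact R 0 1)).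
Qed.

Lemma cell_value_inside M K (t : n.-tuple 'I_M) : inside K t ->
  cell_value V 0 (map val t) K = unit_cell.
Proof.
move=> /asboolP tK; rewrite cell_value_local (setIidr tK).
pose v : 'rV[R]_n := \row_j (nth 0%N (map val t) j)%:R.
have -> : @cube R n 0 (map val t) = [set y + v | y in unit_cube].
  apply/seteqP; split => x.
    move=> /cube_tupleP h; exists (x - v); last by rewrite subrK.
    apply/unit_cubeP => j; rewrite !mxE (nth_map (tnth t j)) ?size_tuple// -tnth_nth.
    by have := h j; rewrite -natr1 => /andP[? ?]; apply/andP; split; lra.
  move=> [y /unit_cubeP h <-]; apply/cube_tupleP => j.
  rewrite !mxE (nth_map (tnth t j)) ?size_tuple// -tnth_nth -natr1.
  by have /andP[? ?] := h j; apply/andP; split; lra.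
rewrite cell_value_shift//.
- by rewrite size_map size_tuple.
- by have /convex_bodyE[] := convex_body_unit_cube.
by move=> j l _; rewrite add0n mxE => ->.
Qed.

(** Cells inside [K] contribute [unit_cell] each, cells missing [K] nothing, and the
    boundary cells a bounded amount each. The factor [M] on the left, in place of
    the exponent [n - 1] on the right, gives the right meaning to [n = 0]. *)
Lemma cell_count_estimate : exists2 D : R, 0 <= D &
  forall (M : nat) K, convex_body K ->
    (forall x j, K x -> 0 <= x ord0 j < M%:R) ->
  `|V K - #|[set t : n.-tuple 'I_M | inside K t]%SET|%:R * unit_cell| * M%:R
    <= D * M%:R ^+ n.
Proof.
have [c c0 cP] := cell_piece_bound.
exists (2 ^+ n * c * (2 * n * n)%N%:R); first by rewrite !mulr_ge0// exprn_ge0.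
move=> M K bK KM; have /convex_bodyE[cK K0] := bK.
rewrite -(extend0_neq0 V K0) (cell_sum vV (k := n) (i := 0%N) (M := M))//.
rewrite (bigID (fun t : n.-tuple 'I_M => inside K t))/=.
rewrite (eq_bigr (fun=> unit_cell)); last by move=> t; exact: cell_value_inside.
rewrite sumr_const -[unit_cell *+ _]mulr_natl.
rewrite [X in X%:R * _](_ : _ = #|[set t : n.-tuple 'I_M | inside K t]%SET|); last first.
  by apply: eq_card => t; rewrite !inE.
rewrite addrC addrK.
have B : `|\sum_(t : n.-tuple 'I_M | ~~ inside K t) cell_value V 0 (map val t) K|
    <= #|@boundary_cells R n M K|%:R * (2 ^+ n * c).
  apply: le_trans (ler_norm_sum _ _ _) _.
  rewrite (bigID (fun t : n.-tuple 'I_M => meets K t))/= [X in _ + X]big1 ?addr0.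
    rewrite mulr_natl -sumr_const.
    rewrite [leRHS](eq_bigl (fun t => ~~ inside K t && meets K t)); last first.
      by move=> t; rewrite inE andbC.
    apply: ler_sum => t _; rewrite -[X in 2 ^+ X](_ : size (map val t) = n);
      last by rewrite size_map size_tuple.
    apply: cell_value_bound => // K' cK' sK'; apply: (cP (map val t)) => //.
      by rewrite size_map size_tuple.
    by move=> x /sK'[].
  move=> t /andP[_ /asboolPn nt].
  suff : `|cell_value V 0 (map val t) K| <= 2 ^+ size (map val t) * 0.
    by rewrite mulr0 normr_le0 => /eqP ->; rewrite normr0.
  apply: cell_value_bound => // K' cK' sK'.
  have -> : K' = set0.
    rewrite -subset0 => x K'x; apply: nt; exists x; exact: sK'.
  by rewrite extend0_set0 normr0.
apply: le_trans (ler_wpM2r (ler0n _ _) B) _.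
rewrite mulrAC -natrM mulrC -[leRHS]mulrA; apply: ler_wpM2l.
  by rewrite mulr_ge0// exprn_ge0.
by rewrite -natrX -natrM ler_nat; exact: card_boundary_cells.
Qed.

Lemma dilated_count_estimate : exists2 D : R, 0 <= D &
  forall (N r : nat) K, (0 < N)%N -> convex_body K ->
    (forall x j, K x -> 0 <= x ord0 j < r%:R) ->
  exists2 k : nat, k = #|[set t : n.-tuple 'I_(N * r) |
                          inside [set N%:R *: y | y in K] t]%SET| &
  `|N%:R `^ m * V K - k%:R * unit_cell| * (N * r)%:R <= D * (N * r)%:R ^+ n.
Proof.
have [D D0 DP] := cell_count_estimate; exists D => // N r K N0 bK Kr.
have N0' : (0:R) < N%:R by rewrite ltr0n.
eexists; first by reflexivity.
have E : V [set N%:R *: y | y in K] = N%:R `^ m * V K.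
  by apply: hV => // /eqP; rewrite gt_eqF.
rewrite -E; apply: DP; first exact: convex_body_scale.
move=> _ j [y Ky <-]; rewrite mxE natrM.
have /andP[h1 h2] := Kr y j Ky.
apply/andP; split; first by rewrite mulr_ge0.
by rewrite ltr_pM2l.
Qed.

Lemma powR_natS (N : nat) (r : R) : (0 < N)%N ->
  N%:R `^ (r + 1) = N%:R `^ r * N%:R.
Proof.
move=> N0; rewrite powRD ?powRr1//.
by apply/implyP => _; rewrite pnatr_eq0 -lt0n.
Qed.

(** If only boundary cells contribute, then [V (N K)] grows at most like
    [N ^ (n - 1)]. *)
Lemma degree_le_of_unit_cell0 : unit_cell = 0 -> nonzero_on_bodies V ->
  m <= n%:R - 1.
Proof.
move=> w0 [K0 bK0 VK0]; have [D D0 DP] := dilated_count_estimate.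
have [r r0 rK] := compact_coord_bounded (let: And3 _ c _ := bK0 in c).
pose v : 'rV[R]_n := const_mx r%:R.
pose K := [set y + v | y in K0].
have bK : convex_body K by exact: convex_body_shift.
have VK : V K != 0 by rewrite tV.
have KP x j : K x -> 0 <= x ord0 j < (2 * r).+1%:R.
  move=> [y Ky <-]; rewrite !mxE -natr1 mulnC natrM.
  by have := rK y j Ky; rewrite ler_norml => /andP[? ?]; apply/andP; split; lra.
rewrite lerBrDr.
apply: (@powR_growth `|V K| (D * (2 * r).+1%:R ^+ n)); first by rewrite normr_gt0.
move=> N N0; have [k _] := DP N _ K N0 bK KP.
rewrite w0 mulr0 subr0 normrM (ger0_norm (powR_ge0 _ _)) natrM => h.
rewrite powR_mulrn// powR_natS// mulrA [`|V K| * _]mulrC.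
rewrite -[leRHS]mulrA -exprMn [_ * N%:R in leRHS]mulrC.
by apply: le_trans h; rewrite mulrA ler_peMr// ?ler1n// !mulr_ge0 ?powR_ge0.
Qed.

(** The dilate [N Q] of the unit cube contains of the order of [N ^ n] cells, which
    dominate the boundary cells, so [V (N Q)] grows exactly like [N ^ n]. *)
Lemma degree_eq_of_unit_cell_neq0 : unit_cell != 0 -> m = n%:R.
Proof.
move=> w0; have [D D0 DP] := dilated_count_estimate.
have w_gt0 : 0 < `|unit_cell| by rewrite normr_gt0.
(* The bounding box has side 2 since it must not contain its upper faces. *)
have QP x j : unit_cube x -> 0 <= x ord0 j < 2%:R.
  move=> /unit_cubeP /(_ j) /andP[-> h]; rewrite (le_lt_trans h)//.
  by rewrite ltr1n.
have H (N : nat) : (0 < N)%N -> exists k : nat,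
   [/\ (N ^ n <= k)%N, (k <= (N * 2) ^ n)%N &
  `|N%:R `^ m * V unit_cube - k%:R * unit_cell| * (N * 2)%:R
    <= D * (N * 2)%:R ^+ n].
  move=> N0; have [k kE kP] := DP N _ _ N0 convex_body_unit_cube QP.
  exists k; split => //; last first.
    by rewrite kE (leq_trans (max_card _))// card_tuple card_ord.
  have wid (a : 'I_N) : (a < N * 2)%N by have := ltn_ord a; lia.
  pose f (t : n.-tuple 'I_N) : n.-tuple 'I_(N * 2) :=
    [tuple of map (fun a => Ordinal (wid a)) t].
  have finj : injective f.
    move=> t t' /(congr1 val)/inj_map h; apply/val_inj/h => a b [ab].
    exact: val_inj.
  rewrite -[N in (N ^ _)%N]card_ord -card_tuple -(card_codom finj) kE.
  apply: subset_leq_card; apply/fintype.subsetP => _ /codomP[t ->].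
  rewrite inE; apply/asboolP => x /cube_tupleP h.
  exists (N%:R^-1 *: x); last first.
    by rewrite scalerA divff ?scale1r// pnatr_eq0 -lt0n.
  apply/unit_cubeP => j; rewrite mxE.
  have := h j; rewrite tnth_map/= => /andP[h1 h2].
  rewrite mulr_ge0 ?invr_ge0 ?(le_trans _ h1)//=.
  rewrite ler_pdivrMl ?ltr0n// mulr1 (le_trans h2)// ler_nat.
  exact: ltn_ord.
have DN (N : nat) : (0 < N)%N ->
    D * (N * 2)%:R ^+ n = D * 2 ^+ n * N%:R `^ n%:R :> R.
  by move=> N0; rewrite powR_mulrn// natrM exprMn; ring.
have normA (N : nat) : `|V unit_cube| * N%:R `^ m = `|N%:R `^ m * V unit_cube|.
  by rewrite normrM (ger0_norm (powR_ge0 _ _)) mulrC.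
have normB (k : nat) : k%:R * `|unit_cell| = `|k%:R * unit_cell|.
  by rewrite normrM normr_nat.
have lower (N : nat) : (0 < N)%N -> `|unit_cell| * N%:R `^ (n%:R + 1) <=
    `|V unit_cube| * N%:R `^ (m + 1) + D * 2 ^+ n * N%:R `^ n%:R.
  move=> N0; have [k [Nk _ kP]] := H N N0.
  have N1 : (1:R) <= N%:R by rewrite ler1n.
  have k' : N%:R `^ n%:R <= k%:R :> R by rewrite powR_mulrn// -natrX ler_nat.
  rewrite !powR_natS// -DN//.
  have h1 : k%:R * `|unit_cell| <= `|V unit_cube| * N%:R `^ m +
      `|N%:R `^ m * V unit_cube - k%:R * unit_cell|.
    rewrite normA normB -lerBlDl distrC; exact: lerB_dist.
  have h2 : `|N%:R `^ m * V unit_cube - k%:R * unit_cell| * N%:R <= D * (N * 2)%:R ^+ n.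
    apply: le_trans kP; apply: ler_wpM2l => //; rewrite ler_nat; lia.
  have h3 : `|unit_cell| * N%:R `^ n%:R <= k%:R * `|unit_cell|.
    by rewrite mulrC ler_pM2r.
  rewrite !mulrA.
  apply: le_trans (ler_wpM2r _ (le_trans h3 h1)) _ => //.
  by rewrite mulrDl lerD2l.
have nm : n%:R <= m.
  rewrite leNgt; apply/negP => mn.
  have : n%:R + 1 <= Num.max (m + 1) n%:R.
    apply: (@powR_growth `|unit_cell| (`|V unit_cube| + D * 2 ^+ n)) => // N N0.
    apply: le_trans (lower N N0) _; rewrite mulrDl.
    have N1 : (1:R) <= N%:R by rewrite ler1n.
    apply: lerD; apply: ler_wpM2l; rewrite ?mulr_ge0 ?exprn_ge0//;
    by apply: ler_powR => //; rewrite le_max lexx ?orbT.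
  by rewrite le_max !lerD2r => /orP[]; lra.
apply/eqP; rewrite eq_le nm andbT.
have VQ : 0 < `|V unit_cube|.
  rewrite normr_gt0; apply/negP => /eqP VQ.
  have : n%:R + 1 <= n%:R :> R.
    apply: (@powR_growth `|unit_cell| (D * 2 ^+ n)) => // N N0.
    by apply: le_trans (lower N N0) _; rewrite VQ normr0 mul0r add0r.
  lra.
apply: (@powR_growth `|V unit_cube| (2 ^+ n * `|unit_cell| + D * 2 ^+ n)) => // N N0.
have [k [_ kN kP]] := H N N0.
rewrite mulrDl -DN//.
have h2 : `|N%:R `^ m * V unit_cube - k%:R * unit_cell| <= D * (N * 2)%:R ^+ n.
  by apply: le_trans kP; rewrite ler_peMr// ler1n; lia.
have k' : k%:R <= 2 ^+ n * N%:R `^ n%:R :> R.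
  by rewrite powR_mulrn// -exprMn -natrM -natrX mulnC ler_nat.
have h3 : k%:R * `|unit_cell| <= 2 ^+ n * `|unit_cell| * N%:R `^ n%:R.
  by rewrite mulrAC ler_pM2r.
apply: le_trans (lerD h3 h2).
rewrite normA normB -lerBlDl; exact: lerB_dist.
Qed.

Lemma degree_restriction : nonzero_on_bodies V ->
  (0 <= m <= n%:R - 1) \/ m = n%:R.
Proof.
move=> nz; have [w0|w0] := eqVneq unit_cell 0; last first.
  by right; exact: degree_eq_of_unit_cell_neq0.
by left; rewrite degree_ge0//= degree_le_of_unit_cell0.
Qed.

End Degrees.

(** * Limits along ultrafilters and the invariant mean on the line *)

Section UltrafilterLimit.
Context {R : realType} {T : Type}.
Implicit Types (U : set_system T) (f g : T -> R).

Definition ulim U f : R := lim (f @ U).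

Lemma ultra_bounded_cvg U f c : UltraFilter U -> (forall x, `|f x| <= c) ->
  cvg (f @ U).
Proof.
move=> UU fc.
have FU : ProperFilter (f @ U) by apply: fmap_proper_filter.
have [|p [_ clp]] := @segment_compact R (- c) c (f @ U) FU.
  by apply: (@filterS _ U _ setT);
    [move=> x _ /=; rewrite in_itv/= -ler_norml|exact: filterT].
apply/cvg_ex; exists p => A pA.
have [//|nA] := in_ultra_setVsetC (f @^-1` A) UU.
by have [x [nAx Ax]] := clp (~` A) A nA pA.
Qed.

Lemma ulimD U f g c d : UltraFilter U ->
  (forall x, `|f x| <= c) -> (forall x, `|g x| <= d) ->
  ulim U (fun x => f x + g x) = ulim U f + ulim U g.
Proof.
move=> UU fc gd; have PU : ProperFilter U by exact: ultra_proper.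
apply: cvg_lim => //.
exact: (cvgD (ultra_bounded_cvg UU fc) (ultra_bounded_cvg UU gd)).
Qed.

Lemma ulimZ U f c a : UltraFilter U -> (forall x, `|f x| <= c) ->
  ulim U (fun x => a * f x) = a * ulim U f.
Proof.
move=> UU fc; have PU : ProperFilter U by exact: ultra_proper.
apply: cvg_lim => //.
exact: (cvgM (cvg_cst a) (ultra_bounded_cvg UU fc)).
Qed.

Lemma ulim_norm_le U f c : UltraFilter U -> (forall x, `|f x| <= c) ->
  `|ulim U f| <= c.
Proof.
move=> UU fc; have cf := ultra_bounded_cvg UU fc.
have PU : ProperFilter U by exact: ultra_proper.
rewrite ler_norml; apply/andP; split.
  by apply: limr_ge => //; apply: nearW => x; have := fc x; rewrite ler_norml => /andP[].
by apply: limr_le => //; apply: nearW => x; have := fc x; rewrite ler_norml => /andP[].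
Qed.

Lemma ulim_cst U a : UltraFilter U -> ulim U (fun=> a) = a.
Proof.
move=> UU; have PU : ProperFilter U by exact: ultra_proper.
by apply: cvg_lim => //; exact: cvg_cst.
Qed.

Lemma ulim_cvg U (F : set_system T) f l : UltraFilter U -> F `<=` U ->
  f @ F --> l -> ulim U f = l.
Proof.
move=> UU FU fl; have PU : ProperFilter U by exact: ultra_proper.
by apply: cvg_lim => // A /fl; exact: FU.
Qed.

End UltrafilterLimit.

Section InvariantMean.
Context {R : realType}.
Implicit Types (f g : R -> R).

Definition orbit_average (N : nat) (c : R) f (x : R) : R :=
  N.+1%:R^-1 * \sum_(i < N.+1) f (x + c *+ i).

Definition iterated_average (N : nat) (s : seq R) f : R -> R :=
  foldr (orbit_average N) f s.

Lemma orbit_averageD N c f g : orbit_average N c (fun x => f x + g x) =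
  fun x => orbit_average N c f x + orbit_average N c g x.
Proof. by apply/funext => x; rewrite /orbit_average big_split/= mulrDr. Qed.

Lemma orbit_averageZ N c f a : orbit_average N c (fun x => a * f x) =
  fun x => a * orbit_average N c f x.
Proof. by apply/funext => x; rewrite /orbit_average -mulr_sumr mulrCA. Qed.

Lemma orbit_average_shift N c f t : orbit_average N c (fun x => f (x + t)) =
  fun x => orbit_average N c f (x + t).
Proof.
apply/funext => x; rewrite /orbit_average; congr (_ * _).
by apply: eq_bigr => i _; rewrite addrAC.
Qed.

Lemma orbit_average_norm N c f a : (forall x, `|f x| <= a) ->
  forall x, `|orbit_average N c f x| <= a.
Proof.
move=> fa x; rewrite /orbit_average normrM gtr0_norm ?invr_gt0//.
rewrite ler_pdivrMl ?ltr0n// (le_trans (ler_norm_sum _ _ _))//.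
apply: le_trans (_ : \sum_(i < N.+1) a <= _); first exact: ler_sum.
by rewrite sumr_const card_ord mulr_natl.
Qed.

Lemma iterated_averageD N s f g : iterated_average N s (fun x => f x + g x) =
  fun x => iterated_average N s f x + iterated_average N s g x.
Proof. by elim: s => //= c s ->; rewrite orbit_averageD. Qed.

Lemma iterated_averageZ N s f a : iterated_average N s (fun x => a * f x) =
  fun x => a * iterated_average N s f x.
Proof. by elim: s => //= c s ->; rewrite orbit_averageZ. Qed.

Lemma iterated_average_shift N s f t :
  iterated_average N s (fun x => f (x + t)) =
  fun x => iterated_average N s f (x + t).
Proof. by elim: s => //= c s ->; rewrite orbit_average_shift. Qed.

Lemma iterated_average_norm N s f a : (forall x, `|f x| <= a) ->
  forall x, `|iterated_average N s f x| <= a.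
Proof. by move=> fa; elim: s => //= c s IH; exact: orbit_average_norm. Qed.

(** Averaging along the orbit of [t] telescopes a difference of translates by [t];
    the other averages do not increase the norm. *)
Lemma iterated_average_almost_invariant N s f a t :
  (forall x, `|f x| <= a) -> t \in s ->
  forall x, `|iterated_average N s f (x + t) - iterated_average N s f x| <=
    2 * a / N.+1%:R.
Proof.
move=> fa; elim: s => //= c s IH; rewrite inE => /orP[/eqP <-|ts] x.
  rewrite /orbit_average -mulrBr -sumrB.
  rewrite (eq_bigr (fun i : 'I_N.+1 => iterated_average N s f (x + t *+ i.+1) -
     iterated_average N s f (x + t *+ i))); last first.
    by move=> i _; rewrite -addrA -mulrS.
  rewrite -(big_mkord xpredT (fun i => iterated_average N s f (x + t *+ i.+1) -
     iterated_average N s f (x + t *+ i))) telescope_sumr//.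
  rewrite normrM gtr0_norm ?invr_gt0// mulrC ler_pM2r ?invr_gt0//.
  rewrite (le_trans (ler_normB _ _))// mulr_natl mulr2n.
  by apply: lerD; exact: iterated_average_norm.
have -> : orbit_average N c (iterated_average N s f) (x + t) -
          orbit_average N c (iterated_average N s f) x =
  orbit_average N c (fun x => iterated_average N s f (x + t) +
     (-1) * iterated_average N s f x) x.
  by rewrite orbit_averageD orbit_averageZ orbit_average_shift mulN1r.
by apply: orbit_average_norm => y; rewrite mulN1r; exact: IH.
Qed.

(** Arbitrarily large finite sets of translations and lengths of averages. *)
Definition averaging_filter : set_system (seq R * nat) :=
  filter_from setT (fun q : seq R * nat =>
    [set p : seq R * nat | {subset q.1 <= p.1} /\ (q.2 <= p.2)%N]).

Lemma averaging_filter_proper : ProperFilter averaging_filter.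
Proof.
apply: filter_from_proper; last by move=> q _; exists q; split.
apply: filter_from_filter; first by exists ([::], 0%N).
move=> q q' _ _; exists (q.1 ++ q'.1, maxn q.2 q'.2) => // p /= [h].
rewrite geq_max => /andP[h1 h2]; split; split => //= x xq; apply: h.
  by rewrite mem_cat xq.
by rewrite mem_cat xq orbT.
Qed.

Definition bounded_fct f := exists c, forall x, `|f x| <= c.

(** Take the limit of the iterated averages at 0 along an ultrafilter finer than
    [averaging_filter]: for each [t] the defect of invariance tends to 0. *)
Lemma invariant_mean_exists : exists M : (R -> R) -> R,
  [/\ forall f g, bounded_fct f -> bounded_fct g ->
        M (fun x => f x + g x) = M f + M g,
      forall f a, bounded_fct f -> M (fun x => a * f x) = a * M f,
      forall f c, (forall x, `|f x| <= c) -> `|M f| <= c,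
      forall f t, bounded_fct f -> M (fun x => f (x + t)) = M f &
      M (fun=> 1) = 1].
Proof.
have [U [UU FU]] := ultraFilterLemma averaging_filter_proper.
have PU : ProperFilter U by exact: ultra_proper.
have PA := averaging_filter_proper.
exists (fun f => ulim U (fun p => iterated_average p.2 p.1 f 0)); split.
- move=> f g [c fc] [d gd]; rewrite -(@ulimD _ _ _ _ _ c d)//.
  + by congr ulim; apply/funext => p; rewrite iterated_averageD.
  + by move=> p; exact: iterated_average_norm.
  + by move=> p; exact: iterated_average_norm.
- move=> f a [c fc]; rewrite -(@ulimZ _ _ _ _ c)//.
  + by congr ulim; apply/funext => p; rewrite iterated_averageZ.
  + by move=> p; exact: iterated_average_norm.
- by move=> f c fc; apply: ulim_norm_le => p; exact: iterated_average_norm.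
- move=> f t [c fc]; apply/eqP; rewrite -subr_eq0; apply/eqP.
  have c0 : 0 <= c by exact: le_trans (fc 0).
  rewrite -mulN1r -(@ulimZ _ _ _ _ c)//; last by move=> p; exact: iterated_average_norm.
  rewrite -(@ulimD _ _ _ _ _ c c)//.
  + apply: (@ulim_cvg _ _ U averaging_filter) => //.
    apply/cvgr0Pnorm_le => // e e0.
    exists ([:: t], Num.truncn (2 * c / e)) => // p /= [/(_ t)].
    rewrite inE eqxx => /(_ isT) tp Np.
    rewrite iterated_average_shift mulN1r.
    apply: le_trans (iterated_average_almost_invariant _ fc tp _) _.
    rewrite ler_pdivrMr// [e * _]mulrC -ler_pdivrMr//.
    by apply: le_trans (ltW (truncnS_gt _)) _; rewrite ler_nat.
  + by move=> p; apply: iterated_average_norm.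
  + by move=> p; rewrite mulN1r normrN; exact: iterated_average_norm.
rewrite -[RHS](@ulim_cst _ _ U 1)//; congr ulim; apply/funext => p.
suff -> : iterated_average p.2 p.1 (fun=> 1) = fun=> 1 by [].
elim: p.1 => //= c s ->; apply/funext => x.
by rewrite /orbit_average sumr_const card_ord mulVf// pnatr_eq0.
Qed.

End InvariantMean.

(** * A finitely additive integral on the line *)

Section AffineMean.
Context {R : realType}.
Implicit Types (f g : R -> R).

(** Half open, so that the integer translates of [step 0 1] tile the line. *)
Definition step (a b x : R) : R := if a <= x < b then 1 else 0.

Definition cut_off (c L : R) f := forall x, `|f x| <= c * step (- L) L x.

Definition test_fct f := exists c L, cut_off c L f.

Lemma step_ge0 a b x : 0 <= step a b x.
Proof. by rewrite /step; case: ifP. Qed.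

Lemma step_le1 a b x : step a b x <= 1.
Proof. by rewrite /step; case: ifP. Qed.

Lemma le_step a b a' b' x : a' <= a -> b <= b' -> step a b x <= step a' b' x.
Proof.
move=> aa bb; rewrite /step; case: (boolP (a <= x < b)) => [/andP[h1 h2]|_].
  by rewrite (le_trans aa h1) (lt_le_trans h2 bb).
by case: ifP.
Qed.

Lemma cut_off_ge0 c L f : cut_off c L f ->
  exists c' L', [/\ 0 <= c', 0 <= L' & cut_off c' L' f].
Proof.
move=> cf; exists `|c|, `|L|; split => // x; apply: le_trans (cf x) _.
apply: le_trans (ler_wpM2r (step_ge0 _ _ _) (ler_norm c)) _.
by apply: ler_wpM2l => //; apply: le_step; rewrite ?lerN2 ler_norm.
Qed.

Lemma test_fctP f : test_fct f <->
  exists (c : R) (L : nat), 0 <= c /\ forall x, `|f x| <= c /\ (L%:R <= `|x| -> f x = 0).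
Proof.
split=> [[c [L /cut_off_ge0[c' [L' [c0 L0 cf]]]]]|[c [L [c0 cf]]]].
  exists c', (Num.truncn L').+1; split => // x; split.
    by apply: le_trans (cf x) _; rewrite ler_piMr// step_le1.
  move=> Lx; have := cf x; rewrite /step.
  have L'x : L' < `|x| by apply: lt_le_trans (truncnS_gt _) Lx.
  case: ifP => [/andP[x1 x2]|_]; last by rewrite mulr0 normr_le0 => /eqP.
  by move: L'x; rewrite ltNge ler_norml x1 (ltW x2).
exists c, L%:R => x; rewrite /step; have [fx f0] := cf x.
case: ifPn; rewrite ?mulr1// mulr0 => h; rewrite f0 ?normr0//.
rewrite leNgt ltr_norml; apply: contra h => /andP[/ltW -> ->].
by [].
Qed.

Lemma test_fctD f g : test_fct f -> test_fct g -> test_fct (fun x => f x + g x).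
Proof.
move=> /test_fctP[c [L [c0 cf]]] /test_fctP[d [M [d0 dg]]].
apply/test_fctP; exists (c + d), (maxn L M); split; first exact: addr_ge0.
move=> x; have [f1 f2] := cf x; have [g1 g2] := dg x; split.
  by rewrite (le_trans (ler_normD _ _))// lerD.
move=> h; rewrite f2 ?g2 ?addr0// (le_trans _ h)// ler_nat ?leq_maxl ?leq_maxr//.
Qed.

Lemma test_fctZ f a : test_fct f -> test_fct (fun x => a * f x).
Proof.
move=> [c [L cf]]; exists (`|a| * c), L => x.
by rewrite normrM -mulrA ler_wpM2l.
Qed.

Lemma test_fct_shift f t : test_fct f -> test_fct (fun x => f (x + t)).
Proof.
move=> /test_fctP[c [L [c0 cf]]]; apply/test_fctP.
exists c, (L + (Num.truncn `|t|).+1)%N; split => // x; have [f1 f2] := cf (x + t).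
split => // h; apply: f2; have := truncnS_gt `|t|; move: h; rewrite natrD.
have := ler_normB (x + t) t; rewrite addrK; lra.
Qed.

Lemma test_fct_step a b : test_fct (step a b).
Proof.
exists 1, (Num.max `|a| `|b| ) => x; rewrite mul1r ger0_norm ?step_ge0//.
apply: le_step; last by rewrite le_max (ler_norm b) orbT.
by rewrite lerNl le_max -normrN ler_norm.
Qed.

(** Its mean over the translations is the integral of [f], as a period has length 1. *)
Definition periodization f (s : R) : R := \sum_(j \in [set: int]) f (s + j%:~R).

Lemma periodizationE (L : nat) f s : (forall x, L%:R <= `|x| -> f x = 0) ->
  periodization f s =
  \sum_(i < (2 * L).+3) f (s + ((i : nat)%:Z - Num.floor s - L.+1%:Z)%:~R).
Proof.
move=> fL; rewrite /periodization.
pose h (i : nat) : int := i%:Z - Num.floor s - L.+1%:Z.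
have hinj : injective h by move=> i j; rewrite /h; lia.
rewrite (fsbigE (map h (iota 0 (2 * L).+3)))//.
- rewrite big_map -(big_mkord xpredT (fun i : nat => f (s + (h i)%:~R))).
  by rewrite /index_iota subn0; apply: eq_bigl => j; rewrite in_setT.
- by rewrite map_inj_uniq ?iota_uniq.
- move=> j _ jr; apply: fL; rewrite leNgt; apply: contra jr => jL.
  have /andP[s1 s2] := floor_itv s.
  have h1 : - L%:Z - 1 < j + Num.floor s.
    rewrite -(ltr_int R) !(rmorphD, rmorphN)/=.
    move: jL s2; rewrite ltr_norml => /andP[h1 h2]; rewrite rmorphD/= => h3.
    by move: h1 h3; rewrite -[(L%:Z)%:~R]/(L%:R); lra.
  have h2 : j + Num.floor s < L%:Z.
    rewrite -(ltr_int R) !(rmorphD, rmorphN)/=.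
    move: jL s1; rewrite ltr_norml => /andP[h1' h2] h3.
    by rewrite -[(L%:Z)%:~R]/(L%:R); lra.
  apply/mapP; exists (absz (j + Num.floor s + L.+1%:Z)).
    by rewrite mem_iota; lia.
  by rewrite /h gez0_abs; lia.
Qed.

Lemma periodization_norm (L : nat) f c s : (forall x, L%:R <= `|x| -> f x = 0) ->
  (forall x, `|f x| <= c) -> `|periodization f s| <= c *+ (2 * L).+3.
Proof.
move=> fL fc; rewrite (periodizationE _ fL) (le_trans (ler_norm_sum _ _ _))//.
apply: le_trans (_ : \sum_(i < (2 * L).+3) c <= _); first exact: ler_sum.
by rewrite sumr_const card_ord.
Qed.

Lemma periodization_bounded f : test_fct f -> bounded_fct (periodization f).
Proof.
move=> /test_fctP[c [L [c0 fP]]]; exists (c *+ (2 * L).+3) => s.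
by apply: periodization_norm => x; have [] := fP x.
Qed.

Lemma periodizationD f g : test_fct f -> test_fct g ->
  periodization (fun x => f x + g x) =
  fun s => periodization f s + periodization g s.
Proof.
move=> /test_fctP[c [L [c0 fP]]] /test_fctP[d [L' [d0 gP]]].
have fL x : (maxn L L')%:R <= `|x| -> f x = 0.
  by move=> h; apply: (fP x).2; rewrite (le_trans _ h)// ler_nat leq_maxl.
have gL x : (maxn L L')%:R <= `|x| -> g x = 0.
  by move=> h; apply: (gP x).2; rewrite (le_trans _ h)// ler_nat leq_maxr.
apply/funext => s; rewrite (periodizationE s fL) (periodizationE s gL).
rewrite (@periodizationE (maxn L L'))// ?big_split// => x h.
by rewrite fL// gL// addr0.
Qed.

Lemma periodizationZ f a :
  periodization (fun x => a * f x) = fun s => a * periodization f s.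
Proof. by apply/funext => s; rewrite /periodization mulr_fsumr. Qed.

Lemma periodization_step01 : periodization (step 0 1) = fun=> 1.
Proof.
apply/funext => s; have /andP[s1 s2] := floor_itv s.
rewrite /periodization (fsbigE [:: - Num.floor s])//.
  rewrite big_cons in_setT big_nil /= addr0 /step rmorphN/= subr_ge0 s1/= ltrBlDl.
  by move: s2; rewrite rmorphD/= => ->.
move=> j _; rewrite inE => jE; rewrite /step; case: ifPn => // /andP[h1 h2].
case/negP: jE; apply/eqP; apply/eqP; rewrite -addr_eq0 eq_le; apply/andP; split.
  rewrite -ltzD1 -(ltr_int R) !rmorphD/=; lra.
have : (-1 : int) < j + Num.floor s; last by lia.
rewrite -(ltr_int R) !(rmorphD, rmorphN)/=; move: s2; rewrite rmorphD/=; lra.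
Qed.

Lemma shift_step a b t x : step a b (x - t) = step (a + t) (b + t) x.
Proof. by rewrite /step lerBrDr ltrBlDr. Qed.

(** Averaging the periodization over the translations gives a translation invariant
    integral [I], with value [l] on intervals of length [l]. Averaging
    [f |-> l^-1 * I (fun x => f (l^-1 * x))] over the multiplicative group of
    dilations [l = expR s] makes it covariant under dilations as well; the interval
    lengths provide the bound that this second mean requires. *)
Lemma affine_integral_exists : exists J : (R -> R) -> R,
  [/\ forall f g, test_fct f -> test_fct g ->
        J (fun x => f x + g x) = J f + J g,
      forall f a, test_fct f -> J (fun x => a * f x) = a * J f,
      exists2 C, 0 <= C & forall f c L, cut_off c L f -> 0 <= c -> 0 <= L ->
        `|J f| <= C * c * L,
      forall f t l, test_fct f -> 0 < l ->
        J (fun x => f (l^-1 * x + t)) = l * J f &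
      J (step 0 1) = 1].
Proof.
have [M [MD MZ Mb Mt M1]] := @invariant_mean_exists R.
pose I f := M (periodization f).
have ID f g : test_fct f -> test_fct g -> I (fun x => f x + g x) = I f + I g.
  by move=> tf tg; rewrite /I periodizationD// MD//; exact: periodization_bounded.
have IZ f a : test_fct f -> I (fun x => a * f x) = a * I f.
  by move=> tf; rewrite /I periodizationZ MZ//; exact: periodization_bounded.
have It f t : test_fct f -> I (fun x => f (x + t)) = I f.
  move=> tf; rewrite /I -(Mt _ t (periodization_bounded tf)); congr M.
  by apply/funext => s; rewrite /periodization; apply: eq_fsbigr => j _; rewrite addrAC.
have M_ge0 h c : (forall x, 0 <= h x <= c) -> 0 <= M h.
  move=> hc; pose k x := h x + (- c / 2) * 1.
  have b1 : bounded_fct (fun _ : R => 1 : R) by exists 1 => x; rewrite normr1.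
  have bh : bounded_fct h.
    by exists c => x; have /andP[h0 h1] := hc x; rewrite ger0_norm.
  have kb x : `|k x| <= c / 2.
    by rewrite /k; have /andP[h0 h1] := hc x; rewrite ler_norml; apply/andP; split; lra.
  have bc : bounded_fct (fun _ : R => (- c / 2) * 1).
    by exists `|- c / 2 * 1|.
  have := Mb k _ kb; rewrite /k MD// MZ// M1 ler_norml => /andP[]; lra.
have I_ge0 f : test_fct f -> (forall x, 0 <= f x) -> 0 <= I f.
  move=> tf f0; have [c cP] := periodization_bounded tf.
  apply: (M_ge0 _ c) => s; apply/andP; split; last first.
    exact: le_trans (ler_norm _) (cP s).
  have /test_fctP[c' [L [_ fP]]] := tf.
  by rewrite (@periodizationE L)// ?sumr_ge0// => x; exact: (fP x).2.
have I_le f g : test_fct f -> test_fct g -> (forall x, f x <= g x) -> I f <= I g.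
  move=> tf tg fg; rewrite -subr_ge0 -mulN1r addrC -IZ// -ID//; last exact: test_fctZ.
  apply: I_ge0; first by apply: test_fctD => //; exact: test_fctZ.
  by move=> x; rewrite mulN1r addrC subr_ge0.
pose F l := I (step 0 l).
have F1 : F 1 = 1 by rewrite /F /I periodization_step01 M1.
have FD a b : 0 <= a -> 0 <= b -> F (a + b) = F a + F b.
  move=> a0 b0; rewrite /F -(It (step 0 b) (- a))//; last exact: test_fct_step.
  rewrite -ID; [|exact: test_fct_step|exact/test_fct_shift/test_fct_step].
  congr I; apply/funext => x; rewrite shift_step add0r [b + a]addrC /step.
  have [xa|ax] := ltP x a.
    by have -> : x < a + b by [lra]; rewrite /= addr0.
  by have -> : 0 <= x by [lra]; rewrite /= add0r.
have F0 : F 0 = 0.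
  have := FD 0 0 (lexx _) (lexx _); rewrite addr0 => h.
  by move: h => /eqP; rewrite -subr_eq0 opprD addrA subrr add0r oppr_eq0 => /eqP.
have Fle a b : a <= b -> F a <= F b.
  by move=> ab; apply: I_le => [||x]; try exact: test_fct_step; exact: le_step.
have FM (n : nat) l : 0 <= l -> F (n%:R * l) = n%:R * F l.
  move=> l0; elim: n => [|n IH]; first by rewrite !mul0r.
  by rewrite -natr1 !mulrDl !mul1r FD// ?IH// mulr_ge0.
(* An additive monotone function is linear. *)
have FE l : 0 <= l -> F l = l.
  move=> l0; apply/eqP; rewrite -subr_eq0 -normr_eq0 eq_le normr_ge0 andbT.
  apply/ler_addgt0Pr => e e0; rewrite add0r.
  pose N := (Num.truncn (e^-1)).+1.
  have N0 : (0:R) < N%:R by rewrite ltr0n.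
  have Ne : e^-1 < N%:R by exact: truncnS_gt.
  have /andP[k1 k2] : (Num.truncn (N%:R * l))%:R <= N%:R * l < (Num.truncn (N%:R * l)).+1%:R.
    by apply: truncn_itv; rewrite mulr_ge0.
  have Fn k : F k%:R = k%:R by rewrite -[k%:R in LHS]mulr1 FM// F1 mulr1.
  have := Fle _ _ k1; have := Fle _ _ (ltW k2); rewrite !Fn FM// -natr1 => h2 h1.
  have : `|N%:R * F l - N%:R * l| <= 1.
    by rewrite ler_norml; move: k2; rewrite -natr1 => k2; apply/andP; split; lra.
  rewrite -mulrBr normrM gtr0_norm// mulrC -ler_pdivlMr// mul1r => /le_trans; apply.
  by rewrite -[leRHS]invrK lef_pV2 ?posrE ?invr_gt0// ltW.
have Ib f c L : cut_off c L f -> 0 <= c -> 0 <= L -> `|I f| <= 2 * c * L.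
  move=> cf c0 L0; have tf : test_fct f by exists c, L.
  have E : I (fun x => c * step (- L) L x) = 2 * c * L.
    rewrite IZ; last exact: test_fct_step.
    have -> : step (- L) L = fun x => step 0 (2 * L) (x + L).
      by apply/funext => x; rewrite -[L in x + L]opprK shift_step; congr step; ring.
    by rewrite It ?[I _]FE ?mulr_ge0//; [ring|exact: test_fct_step].
  rewrite ler_norml; apply/andP; split; last first.
    rewrite -E; apply: I_le => //; first exact/test_fctZ/test_fct_step.
    by move=> x; apply: le_trans (cf x); exact: ler_norm.
  rewrite lerNl -E -mulN1r -IZ//; apply: I_le.
  - exact: test_fctZ.
  - exact/test_fctZ/test_fct_step.
  by move=> x; apply: le_trans (cf x); rewrite mulN1r -normrN ler_norm.
pose D f s := expR (- s) * I (fun x => f (expR (- s) * x)).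
have cut_dil f c L l : 0 < l -> cut_off c L f -> cut_off c (l * L) (fun x => f (l^-1 * x)).
  move=> l0 cf x; apply: le_trans (cf _) _; rewrite le_eqVlt; apply/orP; left.
  apply/eqP; congr (_ * _); rewrite /step; congr (if _ then _ else _).
  by rewrite -mulrN ler_pdivlMl// ltr_pdivrMl.
have Db f c L : cut_off c L f -> 0 <= c -> 0 <= L -> forall s, `|D f s| <= 2 * c * L.
  move=> cf c0 L0 s; rewrite /D normrM (gtr0_norm (expR_gt0 _)).
  have := cut_dil _ _ _ _ (expR_gt0 s) cf; rewrite -expRN => /Ib /(_ c0).
  rewrite mulr_ge0 ?expR_ge0// => /(_ isT) h.
  apply: le_trans (ler_wpM2l (expR_ge0 _) h) _.
  by rewrite expRN mulrCA mulKf// gt_eqF// expR_gt0.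
have tfb f : test_fct f -> bounded_fct (D f).
  move=> [c [L /cut_off_ge0[c' [L' [c0 L0 cf]]]]]; exists (2 * c' * L').
  exact: Db.
have tdil f l : 0 < l -> test_fct f -> test_fct (fun x => f (l^-1 * x)).
  by move=> l0 [c [L cf]]; exists c, (l * L); exact: cut_dil.
have tdile f s : test_fct f -> test_fct (fun x => f (expR (- s) * x)).
  by rewrite expRN; apply: tdil; exact: expR_gt0.
exists (fun f => M (D f)); split.
- move=> f g tf tg; rewrite -MD; try exact: tfb.
  by congr M; apply/funext => s; rewrite /D ID ?mulrDr//; exact: tdile.
- move=> f a tf; rewrite -MZ; last exact: tfb.
  by congr M; apply/funext => s; rewrite /D IZ 1?mulrCA//; exact: tdile.
- by exists 2 => // f c L cf c0 L0; apply: Mb; exact: Db.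
- move=> f t l tf l0.
  have -> : D (fun x => f (l^-1 * x + t)) = fun s => l * D f (s + ln l).
    apply/funext => s; rewrite /D opprD expRD.
    have -> : expR (- ln l) = l^-1 by rewrite expRN lnK.
    rewrite mulrCA !mulrA mulfVK ?gt_eqF//; congr (_ * _).
    rewrite -(It (fun x => f (expR (- s) / l * x)) (t * (l * expR s))); last first.
      have : test_fct (fun x => f ((l * expR s)^-1 * x)).
        by apply: tdil => //; rewrite mulr_gt0// expR_gt0.
      by rewrite invfM -expRN mulrC.
    congr I; apply/funext => x; congr f; rewrite mulrDr expRN; field.
    by rewrite !gt_eqF// expR_gt0.
  by rewrite (MZ (fun s => D f (s + ln l))) ?Mt//; try exact: tfb;
    have [c cP] := tfb _ tf; exists c => x.
rewrite -[RHS]M1; congr M; apply/funext => s; rewrite /D.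
have -> : (fun x => step 0 1 (expR (- s) * x)) = step 0 (expR s).
  apply/funext => x; rewrite /step expRN; congr (if _ then _ else _).
  by rewrite ler_pdivlMl ?expR_gt0// mulr0 ltr_pdivrMl ?expR_gt0// mulr1.
by rewrite [I _]FE ?expR_ge0// -expRD addNr expR0.
Qed.

End AffineMean.

(** * Realizable degrees and projections *)

Section Constructions.
Context {R : realType}.

Definition realizable_degree (n : nat) (m : R) : Prop :=
  exists V : set 'rV[R]_n -> R,
    [/\ valuation V, translation_invariant V, bounded_on_ball V,
        nonzero_on_bodies V & homogeneous m V].

Lemma realizable_degree0 n : realizable_degree n 0.
Proof.
exists (fun=> 1); split=> //.
- by exists 1 => _ [K _ <-]; rewrite normr1.
- exists [set 0]; last exact: oner_neq0.
  apply/convex_bodyE; split; last by exists 0.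
  split; last exact: compact_set1.
  by move=> x y t -> -> _; rewrite /= !scaler0 addr0.
- by move=> l K l0 _ _; rewrite powRr0 mulr1.
Qed.

Definition select n k (h : 'I_k -> 'I_n) (x : 'rV[R]_n) : 'rV[R]_k :=
  \row_i x ord0 (h i).

Lemma select_continuous n k (h : 'I_k -> 'I_n) : continuous (select h).
Proof.
apply: rV_continuous => i.
rewrite [X in continuous X](_ : _ = fun x : 'rV[R]_n => x ord0 (h i));
  last by apply/funext => x; rewrite mxE.
exact: coord_continuous.
Qed.

Lemma select_affine n k (h : 'I_k -> 'I_n) x y (t : R) :
  select h (t *: x + (1 - t) *: y) = t *: select h x + (1 - t) *: select h y.
Proof. by apply/rowP => i; rewrite !mxE. Qed.

Lemma select_ball n k (h : 'I_k -> 'I_n) (x : 'rV[R]_n) : injective h ->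
  euclidean_ball x -> euclidean_ball (select h x).
Proof.
move=> hinj hx; apply: le_trans hx; rewrite ler_wsqrtr//.
rewrite (eq_bigr (fun i => x ord0 (h i) ^+ 2)); last by move=> i _; rewrite mxE.
rewrite [leRHS](bigID (fun j => j \in (h @: 'I_k)%SET))/=.
rewrite big_imset/=; last by move=> i j _ _; exact: hinj.

by rewrite lerDl sumr_ge0// => j _; exact: sqr_ge0.
Qed.

(** Points of [K] and of [L] with the same image span a segment with constant image,
    and this segment meets [K `&` L]. *)
Lemma imageI_of_convexU n k (f : 'rV[R]_n -> 'rV[R]_k) (K L : set 'rV[R]_n) :
  (forall x y (t : R), f (t *: x + (1 - t) *: y) = t *: f x + (1 - t) *: f y) ->
  convex_compact K -> convex_compact L -> convex_compact (K `|` L) ->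
  f @` (K `&` L) = f @` K `&` f @` L.
Proof.
move=> af cK cL cKL; apply/seteqP; split => y.
  by move=> [x [Kx Lx] <-]; split; exists x.
move=> [[a Ka ay] [b Lb bY]].
have [t t01 KLt] := convexU_segment_meet cK cL cKL Ka Lb.
exists (t *: a + (1 - t) *: b) => //.
by rewrite af ay bY -scalerDl addrC subrK scale1r.
Qed.

(** Compose with a coordinate projection. Every body of the smaller space is the
    projection of a body, so the composite does not vanish identically. *)
Lemma realizable_degree_select n k (h : 'I_k -> 'I_n) m : injective h ->
  realizable_degree k m -> realizable_degree n m.
Proof.
move=> hinj [V [vV tV [c cV] [K0 bK0 VK0] hV]].
have bodyh K : convex_body K -> convex_body (select h @` K).
  apply: convex_body_image; first exact: select_continuous.
  exact: select_affine.
exists (fun K => V (select h @` K)); split.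
- move=> K L bK bL bKL.
  have [cK _] := (convex_bodyE K).1 bK; have [cL _] := (convex_bodyE L).1 bL.
  have [cKL _] := (convex_bodyE _).1 bKL.
  rewrite (imageI_of_convexU (@select_affine _ _ h) cK cL cKL) image_setU vV//.
  + exact: bodyh.
  + exact: bodyh.
  + by rewrite -image_setU; exact: bodyh.
- move=> K x bK; rewrite -(tV _ (select h x) (bodyh K bK)); congr V.
  rewrite !image_comp; congr image; apply/funext => y /=.
  by apply/rowP => i; rewrite !mxE.
- exists c => _ [K [bK sK] <-]; apply: cV; exists (select h @` K) => //; split.
    exact: bodyh.
  by move=> _ [x Kx <-]; apply: select_ball => //; exact: sK.
- pose f (y : 'rV[R]_k) : 'rV[R]_n :=
    \row_j (if [pick i | h i == j] is Some i then y ord0 i else 0).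
  exists (f @` K0).
    apply: convex_body_image => //.
      apply: rV_continuous => j; rewrite [X in continuous X](_ : _ = fun y : 'rV[R]_k =>
        if [pick i | h i == j] is Some i then y ord0 i else 0); last first.
        by apply/funext => y; rewrite mxE.
      case: pickP => [i _|_]; first exact: coord_continuous.
      exact: cst_continuous.
    move=> x y t; apply/rowP => j; rewrite !mxE; case: pickP => [i _|_].
      by rewrite !mxE.
    by rewrite !mulr0 addr0.
  suff -> : select h @` (f @` K0) = K0 by [].
  rewrite image_comp -[RHS]image_id; congr image; apply/funext => y /=.
  apply/rowP => i; rewrite !mxE; case: pickP => [i' /eqP/hinj -> //|/(_ i)].
  by rewrite eqxx.
- move=> l K l0 lm bK; rewrite -(hV l _ l0 lm (bodyh K bK)); congr V.
  rewrite !image_comp; congr image; apply/funext => y /=.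
  by apply/rowP => i; rewrite !mxE.
Qed.

End Constructions.

(** * Integration over parallel sections *)

Section Raise.
Context {R : realType}.
Variable n : nat.
Implicit Types (K L : set 'rV[R]_n.+1) (V : set 'rV[R]_n -> R).

Definition tail_of : 'rV[R]_n.+1 -> 'rV[R]_n := select (lift ord0).

Definition cons_rV (t : R) (y : 'rV[R]_n) : 'rV[R]_n.+1 :=
  \row_j (if unlift ord0 j is Some i then y ord0 i else t).

Lemma cons_rV0 t y : cons_rV t y ord0 ord0 = t.
Proof. by rewrite mxE unlift_none. Qed.

Lemma cons_rV_lift t y i : cons_rV t y ord0 (lift ord0 i) = y ord0 i.
Proof. by rewrite mxE liftK. Qed.

Lemma tail_cons_rV t y : tail_of (cons_rV t y) = y.
Proof. by apply/rowP => i; rewrite mxE cons_rV_lift. Qed.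

Lemma cons_rV_tail (x : 'rV[R]_n.+1) : cons_rV (x ord0 ord0) (tail_of x) = x.
Proof.
apply/rowP => j; case: (unliftP ord0 j) => [i ->|->].
  by rewrite cons_rV_lift mxE.
by rewrite cons_rV0.
Qed.

Definition section (K : set 'rV[R]_n.+1) (t : R) : set 'rV[R]_n :=
  [set y | K (cons_rV t y)].

Lemma sectionE K t : section K t = tail_of @` (K `&` @slab R n.+1 0 t t).
Proof.
apply/seteqP; split => y /=.
  move=> Ky; exists (cons_rV t y); last by rewrite tail_cons_rV.
  split=> // j j0; have -> : j = ord0 by apply: val_inj.
  by rewrite cons_rV0 lexx.
move=> [x [Kx /(_ ord0 erefl) xt] <-].
have -> : t = x ord0 ord0 by apply/eqP; rewrite eq_le.
by rewrite /section/= cons_rV_tail.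
Qed.

Lemma convex_compact_section K t : convex_compact K -> convex_compact (section K t).
Proof.
move=> cK; rewrite sectionE; apply: convex_compact_image.
- exact: select_continuous.
- exact: select_affine.
- exact: convex_compact_slab.
Qed.

Lemma section_shift K (x : 'rV[R]_n.+1) t :
  section [set y + x | y in K] t =
  [set y + tail_of x | y in section K (t - x ord0 ord0)].
Proof.
apply/seteqP; split => y /=.
  move=> [z Kz E]; exists (tail_of z); last first.
    by rewrite -(tail_cons_rV t y) -E; apply/rowP => i; rewrite !mxE.
  have -> : t - x ord0 ord0 = z ord0 ord0.
    by rewrite -(cons_rV0 t y) -E mxE addrK.
  by rewrite /section/= cons_rV_tail.
move=> [z Kz <-]; exists (cons_rV (t - x ord0 ord0) z) => //.
apply/rowP => j; rewrite mxE; case: (unliftP ord0 j) => [i ->|->].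
  by rewrite !cons_rV_lift !mxE.
by rewrite !cons_rV0 subrK.
Qed.

Lemma section_scale K l t : 0 < l ->
  section [set l *: y | y in K] t = [set l *: y | y in section K (l^-1 * t)].
Proof.
move=> l0; have ln : l != 0 by rewrite gt_eqF.
apply/seteqP; split => y /=.
  move=> [z Kz E]; exists (tail_of z); last first.
    by rewrite -(tail_cons_rV t y) -E; apply/rowP => i; rewrite !mxE.
  have -> : l^-1 * t = z ord0 ord0.
    by rewrite -(cons_rV0 t y) -E mxE mulKf.
  by rewrite /section/= cons_rV_tail.
move=> [z Kz <-]; exists (cons_rV (l^-1 * t) z) => //.
apply/rowP => j; rewrite mxE; case: (unliftP ord0 j) => [i ->|->].
  by rewrite !cons_rV_lift !mxE.
by rewrite !cons_rV0 mulVKf.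
Qed.

Definition section_value V K (t : R) : R := extend0 V (section K t).

(** The margin 1 is for the right end point, which [step] leaves out. *)
Lemma section_value_cut_off V K c (r : R) : convex_compact K -> 0 <= c ->
  (forall x, K x -> `|x ord0 ord0| <= r) ->
  (forall t, `|section_value V K t| <= c) ->
  cut_off c (r + 1) (section_value V K).
Proof.
move=> cK c0 rK cP t; rewrite /step; case: ifPn => [_|h].
  by rewrite mulr1.
suff E : section K t = set0 by rewrite /section_value E extend0_set0 normr0 mulr0.
rewrite -subset0 => y /= Ky; have := rK _ Ky; rewrite cons_rV0.
by apply/negP; apply: contra h; rewrite ler_norml => /andP[? ?]; apply/andP; split; lra.
Qed.

Lemma section_value_test V m K : homogeneous m V -> bounded_on_ball V ->
  convex_compact K -> test_fct (section_value V K).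
Proof.
move=> hV bV cK; have [r r0 rK] := compact_coord_bounded cK.2.
have [c c0 cP] := extend0_bounded r hV bV.
exists c, (r%:R + 1); apply: section_value_cut_off => // [x|t]; first exact: rK.
apply: cP; first exact: convex_compact_section.
by move=> y i /= Ky; rewrite -(cons_rV_lift t y i); exact: rK.
Qed.

(** Integrate the value of the sections by parallel hyperplanes. Substituting
    [l^-1 * t] for the height [t] contributes one more factor [l], and the value on
    the cylinder of height 1 over [K0] is [V K0]. *)
Lemma realizable_degreeS m : 0 <= m -> @realizable_degree R n m ->
  @realizable_degree R n.+1 (m + 1).
Proof.
move=> m0 [V [vV tV bV [K0 bK0 VK0] hV]].
have [J [JD JZ [C C0 Jb] Jt J1]] := @affine_integral_exists R.
pose W (K : set 'rV[R]_n.+1) := J (section_value V K).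
have cb (K : set 'rV[R]_n.+1) : convex_body K -> convex_compact K by move=> /convex_bodyE[].
have tfV (K : set 'rV[R]_n.+1) : convex_compact K -> test_fct (section_value V K).
  exact: section_value_test hV bV.
have Wscale l K : 0 < l -> convex_body K -> W [set l *: y | y in K] = l `^ (m + 1) * W K.
  move=> l0 bK; rewrite powRD ?powRr1 ?ltW//; last first.
    by apply/implyP => _; rewrite gt_eqF.
  rewrite -mulrA /W -(Jt _ 0)//; last exact/tfV/cb.
  rewrite -JZ; last first.
    have [c [L h]] := tfV K (cb K bK); exists c, (l * L) => t.
    rewrite addr0; apply: le_trans (h _) _; rewrite /step.
    by rewrite -mulrN ler_pdivlMl// ltr_pdivrMl.
  congr J; apply/funext => t.
  rewrite addr0 /section_value section_scale// (extend0_scale hV)//.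
  exact/convex_compact_section/cb.
exists W; split.
- move=> K L bK bL bKL; rewrite /W -!JD; try exact/tfV/cb.
    congr J; apply/funext => t; rewrite /section_value.
    have := @extend0_valuation _ _ V (section K t) (section L t) vV.
    apply; try exact/convex_compact_section/cb.
    exact: (@convex_compact_section _ t (cb _ bKL)).
  apply: tfV; apply: convex_compactI; [exact: cb|exact: (convex_compact_closed (cb _ bL))|].
  exact: (cb _ bL).1.
- move=> K x bK; rewrite /W.
  have := Jt _ (- x ord0 ord0) _ (tfV K (cb _ bK)) ltr01.
  rewrite mul1r => <-; congr J; apply/funext => t.
  rewrite invr1 mul1r /section_value section_shift extend0_shift//.
  exact/convex_compact_section/cb.
- have [c c0 cP] := bounded_on_ballE bV.
  exists (C * c * (1 + 1)) => _ [K [bK sK] <-].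
  apply: Jb => //; apply: section_value_cut_off => //; first exact: cb.
    by move=> x /sK; exact: euclidean_ball_coord.
  move=> t; rewrite /section_value.
  have [->|/set0P S0] := eqVneq (section K t) set0.
    by rewrite extend0_set0 normr0.
  rewrite extend0_neq0//; apply: cP.
    by apply/convex_bodyE; split => //; exact/convex_compact_section/cb.
  move=> y /= /sK; rewrite -{2}(tail_cons_rV t y); apply: select_ball.
  exact: lift_inj.
- pose f (p : R * 'rV[R]_n) := cons_rV p.1 p.2.
  pose K := f @` (`[0, 1]%classic `*` K0).
  have [cK0 K00] := (convex_bodyE K0).1 bK0.
  have secK t : section K t = if 0 <= t <= 1 then K0 else set0.
    apply/seteqP; split => y.
      move=> [[s z] /= [s01 K0z] E].
      have -> : t = s by rewrite -(cons_rV0 t y) -E cons_rV0.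
      have -> : y = z by rewrite -(tail_cons_rV t y) -E tail_cons_rV.
      by rewrite in_itv/= in s01; rewrite s01.
    by case: ifP => // t01 K0y; exists (t, y) => //; split => //=; rewrite in_itv.
  exists K.
    apply/convex_bodyE; split; last first.
      case: K00 => y Ky; exists (cons_rV 0 y), (0, y) => //; split => //=.
      by rewrite in_itv/= lexx ler01.
    split.
      move=> _ _ t [[a x] /= [a01 Kx] <-] [[b y] /= [b01 Ky] <-] t01.
      exists (t * a + (1 - t) * b, t *: x + (1 - t) *: y).
        split => /=; last exact: cK0.1.
        move: a01 b01 t01; rewrite !in_itv/= => /andP[? ?] /andP[? ?] /andP[? ?].
        by apply/andP; split; nra.
      rewrite /f/=; apply/rowP => j; rewrite [RHS]mxE.
      case: (unliftP ord0 j) => [i ->|->].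
        by rewrite cons_rV_lift !mxE liftK.
      by rewrite !cons_rV0 !mxE unlift_none.
    apply: continuous_compact.
      apply: continuous_subspaceT; apply: rV_continuous => j.
      rewrite /f /cons_rV; case: (unliftP ord0 j) => [i ->|->].
        rewrite [X in continuous X](_ : _ = (fun y : 'rV[R]_n => y ord0 i) \o snd); last first.
          by apply/funext => p /=; rewrite mxE liftK.
        move=> p; apply: continuous_comp; first exact: cvg_snd.
        exact: coord_continuous.
      rewrite [X in continuous X](_ : _ = fst); last first.
        by apply/funext => p /=; rewrite mxE unlift_none.
      by move=> p; exact: cvg_fst.
    by apply: compact_setX; [exact: segment_compact|exact: cK0.2].
  (* The heights of the cylinder form the closed unit interval, which differs from
     [step 0 1] by a point; dilation covariance makes the integral of a point 0. *)
  pose pt (t : R) : R := if t == 0 then 1 else 0.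
  have tpt : test_fct pt.
    exists 1, 1 => t; rewrite /pt /step mul1r.
    case: eqVneq => [->|_]; first by rewrite oppr_le0 ler01 ltr01 normr1.
    by rewrite normr0; case: ifP.
  have Jpt : J pt = 0.
    have := Jt pt 0 2 tpt (ltr0Sn _ _).
    have -> : (fun x => pt (2^-1 * x + 0)) = pt.
      by apply/funext => x; rewrite /pt addr0 mulf_eq0 invr_eq0 pnatr_eq0.
    lra.
  suff -> : W K = V K0 by [].
  rewrite /W (_ : section_value V K =
    fun t => V K0 * (step 0 1 t + pt (1^-1 * t + (-1)))); last first.
    apply/funext => t; rewrite /section_value secK /step /pt invr1 mul1r subr_eq0.
    have [->|t1] := eqVneq t 1.
      by rewrite ler01 lexx ltxx /= add0r mulr1 extend0_neq0.
    rewrite [t <= 1]le_eqVlt (negbTE t1)/= addr0; case: ifP => _.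
      by rewrite mulr1 extend0_neq0.
    by rewrite mulr0 extend0_set0.
  have t1 : test_fct (step 0 1 : R -> R) by exact: test_fct_step.
  have t2 : test_fct (fun t => pt (1^-1 * t + (-1))).
    rewrite (_ : (fun _ => _) = fun t => pt (t + (-1))); first exact: test_fct_shift.
    by apply/funext => t; rewrite invr1 mul1r.
  by rewrite JZ ?JD// ?Jt// ?J1 ?Jpt ?mulr0 ?addr0 ?mulr1//; exact: test_fctD.
move=> l K l0 lm bK; have [l00|l00] := eqVneq l 0; last first.
  by apply: Wscale => //; rewrite lt_neqAle eq_sym l00.
have b0 : convex_body [set l *: y | y in K] by exact: convex_body_scale.
(* For [l = 0] the image is its own double, while [2 `^ (m + 1) > 1]. *)
have E : [set 2 *: y | y in [set l *: y | y in K]] = [set l *: y | y in K].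
  rewrite image_comp; congr image; apply/funext => y /=.
  by rewrite l00 !scale0r scaler0.
have := Wscale 2 _ (ltr0Sn _ _) b0; rewrite E.
have : 1 < (2 : R) `^ (m + 1).
  have : (2 : R) <= 2 `^ (m + 1) by apply: le1r_powR; lra.
  lra.
move=> h2 h; rewrite l00 powR0 ?mul0r; last by lra.
have : (2 `^ (m + 1) - 1) * W [set 0 *: y | y in K] = 0.
  by rewrite mulrBl mul1r -l00 -h subrr.
by move=> /eqP; rewrite mulf_eq0 subr_eq0 gt_eqF//= => /eqP.
Qed.

End Raise.

(** * One-sided derivatives of convex functions *)

Section ConvexFunctions.
Context {R : realType}.
Implicit Types (f g u v : R -> R) (x y h : R).

Definition convex_fct f := forall x y t, 0 <= t <= 1 ->
  f (t * x + (1 - t) * y) <= t * f x + (1 - t) * f y.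

Definition lipschitz_fct (L : R) f := forall x y, `|f x - f y| <= L * `|x - y|.

Definition slope f x h := (f (x + h) - f x) / h.

Definition right_derivative f x := inf [set slope f x h | h in [set h | 0 < h]].

Lemma three_point f x h k : convex_fct f -> 0 < h -> 0 < k ->
  (f x - f (x - h)) / h <= slope f x k.
Proof.
move=> cf h0 k0; have hk : 0 < h + k by lra.
have := cf (x - h) (x + k) (k / (h + k)).
have -> : k / (h + k) * (x - h) + (1 - k / (h + k)) * (x + k) = x.
  by field; rewrite gt_eqF.
have -> : 0 <= k / (h + k) <= 1.
  by rewrite ler_pdivrMr// mul1r lerDr (ltW h0) divr_ge0//; exact: ltW.
move=> /(_ isT) H; rewrite /slope ler_pdivrMr// mulrAC ler_pdivlMr//.
have : f x * (h + k) <= k * f (x - h) + h * f (x + k).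
  apply: le_trans (ler_wpM2r (ltW hk) H) _; rewrite le_eqVlt; apply/orP; left.
  by apply/eqP; field; rewrite gt_eqF.
by lra.
Qed.

Lemma slope_mono f x h k : convex_fct f -> 0 < h -> h <= k ->
  slope f x h <= slope f x k.
Proof.
move=> cf h0 hk; have k0 : 0 < k by lra.
have := cf (x + k) x (h / k).
have -> : h / k * (x + k) + (1 - h / k) * x = x + h by field; rewrite gt_eqF.
have -> : 0 <= h / k <= 1.
  by rewrite ler_pdivrMr// mul1r hk divr_ge0//; exact: ltW.
move=> /(_ isT) H.
rewrite /slope ler_pdivrMr// lerBlDr; apply: le_trans H _.
by rewrite le_eqVlt; apply/orP; left; apply/eqP; field; rewrite gt_eqF.
Qed.

Lemma slope_has_inf f x : convex_fct f ->
  has_inf [set slope f x h | h in [set h | 0 < h]].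
Proof.
move=> cf; split; first by exists (slope f x 1), 1 => //=.
exists ((f x - f (x - 1)) / 1) => _ [h /= h0 <-].
exact: three_point.
Qed.

Lemma right_derivative_le f x h : convex_fct f -> 0 < h ->
  right_derivative f x <= slope f x h.
Proof.
by move=> cf h0; apply: (ge_inf (slope_has_inf x cf).2); exists h.
Qed.

Lemma right_derivative_ge f x h : convex_fct f -> 0 < h ->
  (f x - f (x - h)) / h <= right_derivative f x.
Proof.
move=> cf h0; apply: lb_le_inf; first exact: (slope_has_inf x cf).1.
by move=> _ [k /= k0 <-]; exact: three_point.
Qed.

Lemma right_derivative_approx f x e : convex_fct f -> 0 < e ->
  exists2 h0, 0 < h0 & forall h, 0 < h -> h <= h0 -> slope f x h < right_derivative f x + e.
Proof.
move=> cf e0; have [_ [h0 /= h00 <-] H] := inf_adherent e0 (slope_has_inf x cf).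
by exists h0 => // h hp hh; apply: le_lt_trans H; exact: slope_mono.
Qed.

Lemma right_derivative_eq f x d : convex_fct f ->
  (forall h, 0 < h -> d <= slope f x h) ->
  (forall e, 0 < e -> exists2 h, 0 < h & slope f x h < d + e) ->
  right_derivative f x = d.
Proof.
move=> cf H1 H2; apply/eqP; rewrite eq_le; apply/andP; split.
  apply/ler_addgt0Pr => e /H2[h h0 hd].
  by apply: le_trans (right_derivative_le _ cf h0) _; exact: ltW.
apply: lb_le_inf; first exact: (slope_has_inf x cf).1.
by move=> _ [h /= h0 <-]; exact: H1.
Qed.

(** Difference quotients of a convex function are monotone in the increment, so any
    increments tending to 0 determine the right derivative. *)
Lemma right_derivative_agree u v x : convex_fct u -> convex_fct v ->
  u x = v x ->
  (forall e, 0 < e -> exists2 h, 0 < h < e & u (x + h) = v (x + h)) ->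
  right_derivative u x = right_derivative v x.
Proof.
have le a b : convex_fct a -> convex_fct b -> a x = b x ->
  (forall e, 0 < e -> exists2 h, 0 < h < e & a (x + h) = b (x + h)) ->
  right_derivative a x <= right_derivative b x.
  move=> ca cb ab H; apply/ler_addgt0Pr => e e0.
  have [h0 h00 H0] := right_derivative_approx x cb e0.
  have [h /andP[h1 h2] E] := H _ h00.
  apply: le_trans (right_derivative_le _ ca h1) _.
  by have := ltW (H0 h h1 (ltW h2)); rewrite /slope E ab.
move=> cu cv E H; apply/eqP; rewrite eq_le !le//.
by move=> e /H[h h1 h2]; exists h.
Qed.

Lemma right_derivative_affine f a b x : convex_fct f ->
  convex_fct (fun y => f y + (a * y + b)) ->
  right_derivative (fun y => f y + (a * y + b)) x = right_derivative f x + a.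
Proof.
move=> cf cf'.
have E h : 0 < h -> slope (fun y => f y + (a * y + b)) x h = slope f x h + a.
  by move=> h0; rewrite /slope; field; rewrite gt_eqF.
apply: right_derivative_eq => // [h h0|e e0].
  by rewrite E// lerD2r right_derivative_le.
have [h h0 H] := right_derivative_approx x cf e0.
by exists h => //; rewrite E// addrAC ltrD2r H.
Qed.

Lemma right_derivative_scale f l x : convex_fct f -> 0 <= l ->
  convex_fct (fun y => l * f y) ->
  right_derivative (fun y => l * f y) x = l * right_derivative f x.
Proof.
move=> cf l0 clf.
have E h : slope (fun y => l * f y) x h = l * slope f x h.
  by rewrite /slope mulrA mulrBr.
apply: right_derivative_eq => // [h h0|e e0].
  by rewrite E ler_wpM2l// right_derivative_le.
have [h h0 H] := right_derivative_approx x cf (divr_gt0 e0 (ltr_wpDl l0 ltr01)).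
exists h => //; rewrite E.
have := ltW (H h h0 (lexx _)); move=> /(ler_wpM2l l0) /le_lt_trans; apply.
rewrite mulrDr ltrD2l mulrCA gtr_pMr// ltr_pdivrMr; last by lra.
by rewrite mul1r ltrDl.
Qed.

Lemma right_derivative_homo f : convex_fct f -> nondecreasing_fun (right_derivative f).
Proof.
move=> cf x y; rewrite le_eqVlt => /predU1P[->//|xy].
have yx : 0 < y - x by rewrite subr_gt0.
apply: le_trans (right_derivative_le x cf yx) _.
apply: le_trans (right_derivative_ge y cf yx).
by rewrite /slope subKr [x + _]addrC subrK.
Qed.

Lemma lipschitz_fct_continuous L f : lipschitz_fct L f -> continuous f.
Proof.
move=> Lf x; apply/cvgrPdist_le => e e0.
have L1 : 0 < `|L| + 1 by apply: ltr_wpDl.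
exists (e / (`|L| + 1)) => /=; first by rewrite divr_gt0.
move=> y /= /ltW xy; apply: le_trans (Lf _ _) _.
apply: (@le_trans _ _ ((`|L| + 1) * `|x - y|)).
  by apply: ler_wpM2r => //; rewrite (le_trans (ler_norm L))// lerDl.
by rewrite -ler_pdivlMl// mulrC.
Qed.

(** With [h = 1 / (k + 1)], the error of the one-sided first order expansion over
    [h], divided by [h ^ 2]: a discrete second derivative. Besides the right
    derivative it involves only one point other than [x], which makes it compatible
    with maxima and minima. *)
Definition taylor_rem (k : nat) f x : R :=
  k.+1%:R ^+ 2 * (f (x + k.+1%:R^-1) - f x - right_derivative f x * k.+1%:R^-1).

Lemma taylor_rem_ge0 k f x : convex_fct f -> 0 <= taylor_rem k f x.
Proof.
move=> cf; rewrite mulr_ge0 ?sqr_ge0// subr_ge0.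
have k0 : (0:R) < k.+1%:R^-1 by rewrite invr_gt0.
have := right_derivative_le x cf k0; rewrite /slope ler_pdivlMr//.
Qed.

Definition second_difference (k : nat) f x : R :=
  k.+1%:R ^+ 2 * ((f (x + k.+1%:R^-1) - f x) - (f x - f (x - k.+1%:R^-1))).

Lemma taylor_rem_le k f x : convex_fct f -> taylor_rem k f x <= second_difference k f x.
Proof.
move=> cf; have k0 : (0:R) < k.+1%:R^-1 by rewrite invr_gt0.
rewrite /taylor_rem /second_difference; apply: ler_wpM2l; first exact: sqr_ge0.
rewrite lerB// -ler_pdivrMr//; exact: right_derivative_ge.
Qed.

Lemma taylor_rem_measurable L k f D : measurable D -> convex_fct f -> lipschitz_fct L f ->
  measurable_fun D (taylor_rem k f).
Proof.
move=> mD cf Lf; apply: measurable_funM; first exact: measurable_cst.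
apply: measurable_funB.
  apply: measurable_funB.
    apply: (measurableT_comp (continuous_measurable_fun (lipschitz_fct_continuous Lf))).
    by apply: measurable_funD; [exact: measurable_id|exact: measurable_cst].
  apply: (measurable_funS measurableT (subsetT _)).
  exact: continuous_measurable_fun (lipschitz_fct_continuous Lf).
apply: measurable_funM; last exact: measurable_cst.
by apply: nondecreasing_measurable => //; exact: right_derivative_homo.
Qed.

End ConvexFunctions.

(** * Integrals of discrete second derivatives *)

Section Integrals.
Context {R : realType}.
Implicit Types (f g G : R -> R).
Local Notation mu := (@lebesgue_measure R).

Lemma bounded_integrable_itv f (a b c : R) : measurable_fun `[a, b] f ->
  (forall x, a <= x <= b -> `|f x| <= c) ->
  mu.-integrable `[a, b] (EFin \o f).
Proof.
move=> mf fc; apply: measurable_bounded_integrable => //=.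
- by rewrite lebesgue_measure_itv/=; case: ifP; rewrite ?ltry// -EFinB ltry.
exists c; split; first exact: num_real.
by move=> M cM x /=; rewrite in_itv/= => /fc /le_trans; apply; exact: ltW.
Qed.

Lemma Rintegral_norm_le f (a b c : R) : a <= b -> measurable_fun `[a, b] f ->
  (forall x, a <= x <= b -> `|f x| <= c) ->
  `|\int[mu]_(x in `[a, b]) f x| <= c * (b - a).
Proof.
move=> ab mf fc; have fi := bounded_integrable_itv mf fc.
apply: le_trans (le_normr_Rintegral _ fi) _ => //.
have -> : c * (b - a) = \int[mu]_(x in `[a, b]) c.
  rewrite Rintegral_cst//= lebesgue_measure_itv/= lte_fin.
  case: ltP => //= ba; have -> : a = b by apply/eqP; rewrite eq_le ab.
  by rewrite subrr.
apply: le_Rintegral => //.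
- apply: (bounded_integrable_itv (c := c)); first exact: measurableT_comp.
  by move=> x xab; rewrite normr_id fc.
- by apply: (bounded_integrable_itv (c := `|c|)).
Qed.

Lemma integral_shift G (c : R) : continuous G ->
  \int[mu]_(x in `[c, 1 + c]) G x = \int[mu]_(x in `[0, 1]) G (x + c).
Proof.
move=> cG; pose F := fun x : R => x + c.
have dFx (x : R) : is_derive x (1 : R) F 1.
  have H : is_derive x (1 : R) F (1 + 0).
    exact: (is_deriveD (is_derive_id x 1) (is_derive_cst c x 1)).
  by rewrite addr0 in H.
have dF : derive1 F = fun=> 1.
  by apply/funext => x; rewrite derive1E; have [_ ->] := dFx x.
have := @integration_by_substitution_increasing R F G 0 1 ler01.
rewrite /F add0r => H; rewrite /Rintegral H.
- by congr fine; apply: eq_integral => x _; rewrite -/F /= dF/= mulr1.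
- by move=> x y _ _; rewrite ltrD2r.
- by rewrite -/F dF => x _; exact: cvg_cst.
- by rewrite -/F dF; exact: is_cvg_cst.
- by rewrite -/F dF; exact: is_cvg_cst.
- split.
  + by move=> x _; have [] := dFx x.
  + apply: cvg_at_right_filter.
    by apply: cvgD; [exact: cvg_id|exact: cvg_cst].
  + apply: cvg_at_left_filter.
    by apply: cvgD; [exact: cvg_id|exact: cvg_cst].
- exact: continuous_subspaceT.
Qed.

Lemma measurable_shift G (a : R) (D : set R) : continuous G -> measurable D ->
  measurable_fun D (fun x => G (x + a)).
Proof.
move=> cG mD; apply: (measurable_funS measurableT (@subsetT _ D)).
have mG : measurable_fun setT G by exact: continuous_measurable_fun.
apply: (measurableT_comp mG).
by apply: measurable_funD; [exact: measurable_id|exact: measurable_cst].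
Qed.

(** The integral of an increment telescopes to the two ends of the interval. *)
Lemma integral_increment G (a c : R) : 0 <= a -> continuous G ->
  (forall x, `|G x| <= c) ->
  \int[mu]_(x in `[0, 1]) (G (x + a) - G x) <= 2 * a * c.
Proof.
move=> a0 cG Gc.
have mG D : measurable D -> measurable_fun D G.
  by move=> mD; apply: (measurable_funS measurableT) => //; exact: continuous_measurable_fun.
have iG x y : mu.-integrable `[x, y] (EFin \o G).
  by apply: (bounded_integrable_itv (c := c)) => //; apply: mG.
have iG' x y : mu.-integrable `]x, y] (EFin \o G).
  by apply: integrableS (iG x y) => //; exact: subset_itv_oc_cc.
rewrite RintegralB//; last first.
  apply: (bounded_integrable_itv (c := c)) => //.
  exact: measurable_shift.
rewrite -integral_shift//.
have E1 : \int[mu]_(x in `[0, 1 + a]) G x - \int[mu]_(x in `[0, 1]) G x =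
    \int[mu]_(x in `[1, 1 + a]) G x.
  rewrite (Rintegral_itvB (iG _ _)) ?bnd_simp ?lerDl//.
  by rewrite Rintegral_itv_obnd_cbnd//; exact: iG'.
have E2 : \int[mu]_(x in `[0, 1 + a]) G x - \int[mu]_(x in `[0, a]) G x =
    \int[mu]_(x in `[a, 1 + a]) G x.
  rewrite (Rintegral_itvB (iG _ _)) ?bnd_simp ?lerDr//.
  by rewrite Rintegral_itv_obnd_cbnd//; exact: iG'.
have B1 : `|\int[mu]_(x in `[1, 1 + a]) G x| <= c * (1 + a - 1).
  by apply: Rintegral_norm_le => //; [rewrite lerDl|apply: mG].
have B2 : `|\int[mu]_(x in `[0, a]) G x| <= c * (a - 0).
  by apply: Rintegral_norm_le => //; apply: mG.
move: B1 B2; rewrite !ler_norml => /andP[? ?] /andP[? ?]; nra.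
Qed.

Lemma second_difference_integral k f L : continuous f -> lipschitz_fct L f ->
  \int[mu]_(x in `[0, 1]) second_difference k f x <= 2 * L.
Proof.
move=> cf Lf; pose a : R := k.+1%:R^-1.
have a0 : 0 < a by rewrite invr_gt0.
pose G x := f x - f (x - a).
have cG : continuous G.
  move=> x; apply: cvgB; first exact: cf.
  apply: (@cvg_comp _ _ _ (fun x => x - a) f _ (nbhs (x - a))); last exact: cf.
  by apply: cvgB; [exact: cvg_id|exact: cvg_cst].
have Gb x : `|G x| <= L * a.
  by apply: le_trans (Lf _ _) _; rewrite subKr gtr0_norm.
have E : second_difference k f = fun x => k.+1%:R ^+ 2 * (G (x + a) - G x).
  by apply/funext => x; rewrite /second_difference /G addrK.
have iG : mu.-integrable `[0, 1] (EFin \o (fun x => G (x + a) - G x)).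
  apply: (bounded_integrable_itv (c := L * a + L * a)).
    apply: (measurable_funS measurableT) => //; apply: measurable_funB.
      exact: measurable_shift.
    exact: continuous_measurable_fun.
  by move=> x _; apply: le_trans (ler_normB _ _) _; apply: lerD.
rewrite E RintegralZl//.
apply: le_trans (ler_wpM2l (sqr_ge0 _) (integral_increment (ltW a0) cG Gb)) _.
rewrite le_eqVlt; apply/orP; left; apply/eqP; rewrite /a; field.
by rewrite addrC natr1.
Qed.

Lemma taylor_rem_bound k f L x : convex_fct f -> lipschitz_fct L f ->
  `|taylor_rem k f x| <= k.+1%:R ^+ 2 * (L * k.+1%:R^-1 + L * k.+1%:R^-1).
Proof.
move=> cf Lf; rewrite ger0_norm ?taylor_rem_ge0//.
apply: le_trans (taylor_rem_le _ _ cf) _; apply: ler_wpM2l; first exact: sqr_ge0.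
apply: le_trans (ler_norm _) _; apply: le_trans (ler_normB _ _) _; apply: lerD.
  by apply: le_trans (Lf _ _) _; rewrite addrAC subrr add0r gtr0_norm// invr_gt0.
by apply: le_trans (Lf _ _) _; rewrite subKr gtr0_norm// invr_gt0.
Qed.

(** The slope of a function with Lipschitz constant [L] varies by at most [2 * L]. *)
Lemma taylor_rem_integral k f L : convex_fct f -> lipschitz_fct L f ->
  \int[mu]_(x in `[0, 1]) taylor_rem k f x <= 2 * L.
Proof.
move=> cf Lf; apply: le_trans (second_difference_integral k (lipschitz_fct_continuous Lf) Lf).
apply: le_Rintegral => //.
- apply: bounded_integrable_itv; first exact: taylor_rem_measurable Lf.
  by move=> x _; exact: taylor_rem_bound Lf.
- have mf := continuous_measurable_fun (lipschitz_fct_continuous Lf).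
  apply: (bounded_integrable_itv (c := k.+1%:R ^+ 2 * (L * k.+1%:R^-1 + L * k.+1%:R^-1))).
    apply: (measurable_funS measurableT) => //.
    apply: measurable_funM; first exact: measurable_cst.
    apply: measurable_funB; apply: measurable_funB => //;
    apply: (measurableT_comp mf).
      by apply: measurable_funD; [exact: measurable_id|exact: measurable_cst].
    by apply: measurable_funB; [exact: measurable_id|exact: measurable_cst].
  move=> x _; rewrite normrM ger0_norm ?sqr_ge0//; apply: ler_wpM2l; first exact: sqr_ge0.
  apply: le_trans (ler_normB _ _) _; apply: lerD.
    by apply: le_trans (Lf _ _) _; rewrite addrAC subrr add0r gtr0_norm// invr_gt0.
  by apply: le_trans (Lf _ _) _; rewrite subKr gtr0_norm// invr_gt0.
by move=> x _; exact: taylor_rem_le.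
Qed.

End Integrals.

(** * Maximum and minimum of two convex functions *)

Section Defect.
Context {R : realType}.
Implicit Types (f g G : R -> R).
Local Notation mu := (@lebesgue_measure R).

(** With [e] arbitrarily small, this plays the role of uniform integrability for
    powers of functions with bounded integrals. *)
Lemma powR_sublinear (p e : R) : 0 < p < 1 -> 0 < e ->
  exists2 C, 0 < C & forall r, 0 <= r -> r `^ p <= C + e * r.
Proof.
move=> /andP[p0 p1] e0; pose d := e `^ (1 - p)^-1.
have d0 : 0 < d by exact: powR_gt0.
exists (d `^ (- p)); first exact: powR_gt0.
move=> r r0.
have Ed : e = d `^ (- p) * d.
  rewrite -{2}[d]powRr1 ?ltW// -powRD; last by apply/implyP => _; rewrite gt_eqF.
  rewrite /d -powRrM [- p + 1]addrC mulVf ?powRr1// ?ltW//.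
  by rewrite gt_eqF// subr_gt0.
have -> : d `^ (- p) + e * r = d `^ (- p) * (1 + d * r).
  by rewrite {1}Ed mulrDr mulr1 mulrA.
rewrite powRN ler_pdivlMl ?powR_gt0// -powRM ?(ltW d0)//.
have dr0 : 0 <= d * r by rewrite mulr_ge0// ltW.
have [dr1|dr1] := leP (d * r) 1.
  apply: (@le_trans _ _ (1 `^ p)); last by rewrite powR1 lerDl.
  by apply: ge0_ler_powR; rewrite ?nnegrE// ltW.
by apply: (@le_trans _ _ (d * r)); [apply: ler1_powR; exact: ltW|rewrite lerDr].
Qed.

Variables (f g : R -> R) (L p : R).
Hypothesis p01 : 0 < p < 1.
Let M x := Num.max (f x) (g x).
Let m x := Num.min (f x) (g x).
Hypotheses (cf : convex_fct f) (cg : convex_fct g).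
Hypotheses (cM : convex_fct M) (cm : convex_fct m).
Hypotheses (Lf : lipschitz_fct L f) (Lg : lipschitz_fct L g).
Hypotheses (LM : lipschitz_fct L M) (Lm : lipschitz_fct L m).

Definition right_isolated := [set x | f x = g x /\
  exists2 e, 0 < e & forall h, 0 < h < e -> f (x + h) <> g (x + h)].

(** To the right of each such point there is a rational number with no other such
    point in between. *)
Lemma countable_right_isolated : countable right_isolated.
Proof.
have H x : exists q : rat, right_isolated x ->
    x < ratr q :> R /\ forall y, x < y < ratr q -> ~ right_isolated y.
  have [[_ [e e0 he]]|nx] := pselect (right_isolated x); last by exists 0.
  have [q qx] := @rat_in_itvoo R x (x + e) (ltr_pwDr e0 (lexx _)).
  exists q => _; move: qx; rewrite in_itv/= => /andP[q1 q2]; split => //.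
  move=> y /andP[xy yq] [fgy _]; apply: (he (y - x)).
    by apply/andP; split; lra.
  by rewrite addrC subrK.
have [q qP] := choice H.
apply/countable_injP; exists (fun x => pickle (q x)).
have lt x y : right_isolated x -> right_isolated y -> q x = q y -> ~ x < y.
  move=> bx bY E xy; have [x1 x2] := qP x bx; have [y1 _] := qP y bY.
  by apply: (x2 y _ bY); rewrite xy E.
move=> x y /set_mem bx /set_mem bY /(pcan_inj pickleK) E.
apply/eqP; rewrite eq_le !leNgt; apply/andP; split; apply/negP.
  by apply: lt => //; rewrite E.
exact: lt.
Qed.

Lemma taylor_rem_agree k (u v : R -> R) x : u x = v x ->
  u (x + k.+1%:R^-1) = v (x + k.+1%:R^-1) ->
  right_derivative u x = right_derivative v x ->
  taylor_rem k u x = taylor_rem k v x.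
Proof. by rewrite /taylor_rem => -> -> ->. Qed.

Definition defect (k : nat) (x : R) : R :=
  (taylor_rem k M x `^ p + taylor_rem k m x `^ p) -
  (taylor_rem k f x `^ p + taylor_rem k g x `^ p).

Lemma near_small (e : R) : 0 < e -> \forall k \near \oo, k.+1%:R^-1 < e.
Proof.
move=> e0; exists (Num.truncn e^-1) => // k /= hk.
rewrite -[ltRHS]invrK ltf_pV2 ?posrE ?invr_gt0//.
by apply: lt_le_trans (truncnS_gt _) _; rewrite ler_nat.
Qed.

Lemma defect_strict (u v : R -> R) x : convex_fct u -> convex_fct v ->
  continuous u -> continuous v -> convex_fct (fun y => Num.max (u y) (v y)) ->
  convex_fct (fun y => Num.min (u y) (v y)) -> v x < u x ->
  \forall k \near \oo,
    taylor_rem k (fun y => Num.max (u y) (v y)) x = taylor_rem k u x /\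
    taylor_rem k (fun y => Num.min (u y) (v y)) x = taylor_rem k v x.
Proof.
move=> cu cv ku kv cmax cmin vu.
have : \forall y \near x, v y < u y.
  have h : continuous_at x (fun y => u y - v y) by apply: cvgB; [exact: ku|exact: kv].
  have d0 : 0 < u x - v x by rewrite subr_gt0.
  have H : \forall y \near x, 0 < u y - v y by exact: (@cvgr_gt R R _ _ _ _ h 0 d0).
  by apply: filterS H => y; rewrite subr_gt0.
move=> /nbhs_ballP[e /= e0 he].
have H h : 0 <= h < e -> v (x + h) < u (x + h).
  move=> /andP[h0 h1]; apply: he; rewrite /ball/= opprD addrA subrr sub0r normrN.
  by rewrite ger0_norm.
have Dmax : right_derivative (fun y => Num.max (u y) (v y)) x = right_derivative u x.
  apply: right_derivative_agree => //; first by rewrite max_l// ltW.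
  move=> e' e'0; exists (Num.min e e' / 2).
    have : 0 < Num.min e e' by rewrite lt_min e0.
    have : Num.min e e' <= e' by rewrite ge_min lexx orbT.
    by move=> ? ?; apply/andP; split; lra.
  rewrite max_l// ltW// H//.
  have : 0 < Num.min e e' by rewrite lt_min e0.
  have : Num.min e e' <= e by rewrite ge_min lexx.
  by move=> ? ?; apply/andP; split; lra.
have Dmin : right_derivative (fun y => Num.min (u y) (v y)) x = right_derivative v x.
  apply: right_derivative_agree => //; first by rewrite min_r// ltW.
  move=> e' e'0; exists (Num.min e e' / 2).
    have : 0 < Num.min e e' by rewrite lt_min e0.
    have : Num.min e e' <= e' by rewrite ge_min lexx orbT.
    by move=> ? ?; apply/andP; split; lra.
  rewrite min_r// ltW// H//.
  have : 0 < Num.min e e' by rewrite lt_min e0.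
  have : Num.min e e' <= e by rewrite ge_min lexx.
  by move=> ? ?; apply/andP; split; lra.
apply: filterS (near_small e0) => k ke.
have Hk : v (x + k.+1%:R^-1) < u (x + k.+1%:R^-1) by apply: H; rewrite ke invr_ge0 ler0n.
split; apply: taylor_rem_agree => //; rewrite ?max_l ?min_r//; exact: ltW.
Qed.

(** Where [f] and [g] differ, the maximum and the minimum locally coincide with one
    of them each. At a right accumulation point of coincidences all four functions
    have the same value and the same right derivative, and at the other point
    involved in the remainder the maximum and the minimum are [f] and [g] up to
    order. *)
Lemma defect_eventually0 x : ~ right_isolated x -> \forall k \near \oo, defect k x = 0.
Proof.
move=> nx; have kf := lipschitz_fct_continuous Lf; have kg := lipschitz_fct_continuous Lg.
have [fg|gf|E] := ltgtP (f x) (g x).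
- have := @defect_strict g f x cg cf kg kf.
  have EM : (fun y => Num.max (g y) (f y)) = M by apply/funext => y; rewrite /M maxC.
  have Em : (fun y => Num.min (g y) (f y)) = m by apply/funext => y; rewrite /m minC.
  rewrite EM Em => /(_ cM cm fg) H; apply: filterS H => k [E1 E2].
  by rewrite /defect E1 E2 [X in _ - X]addrC subrr.
- have H := @defect_strict f g x cf cg kf kg cM cm gf; apply: filterS H => k [E1 E2].
  by rewrite /defect E1 E2 subrr.
have acc e : 0 < e -> exists2 h, 0 < h < e & f (x + h) = g (x + h).
  move=> e0; apply: contrapT => H; apply: nx; split => //; exists e => // h h0 E'.
  by apply: H; exists h.
have D1 : right_derivative f x = right_derivative g x by exact: right_derivative_agree.
have D2 : right_derivative M x = right_derivative f x.
  apply: right_derivative_agree => //; first by rewrite /M E maxxx.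
  by move=> e /acc[h h0 h1]; exists h => //; rewrite /M h1 maxxx.
have D3 : right_derivative m x = right_derivative f x.
  apply: right_derivative_agree => //; first by rewrite /m E minxx.
  by move=> e /acc[h h0 h1]; exists h => //; rewrite /m h1 minxx.
near=> k; rewrite /defect /taylor_rem D2 D3 D1 /M /m E maxxx minxx.
have [_|_] := leP (f (x + k.+1%:R^-1)) (g (x + k.+1%:R^-1)).
  by rewrite [X in _ - X]addrC subrr.
by rewrite subrr.
Unshelve. all: by end_near. Qed.

End Defect.

(** * Integrals of powers of discrete second derivatives *)

Section PowerIntegral.
Context {R : realType}.
Implicit Types (f g : R -> R).
Local Notation mu := (@lebesgue_measure R).

Lemma integrable01D f g :
  mu.-integrable `[0, 1] (EFin \o f) -> mu.-integrable `[0, 1] (EFin \o g) ->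
  mu.-integrable `[0, 1] (EFin \o (fun x => f x + g x)).
Proof. by move=> fi gi; exact: (integrableD _ fi gi). Qed.

Lemma integrable01B f g :
  mu.-integrable `[0, 1] (EFin \o f) -> mu.-integrable `[0, 1] (EFin \o g) ->
  mu.-integrable `[0, 1] (EFin \o (fun x => f x - g x)).
Proof. by move=> fi gi; exact: (integrableB _ fi gi). Qed.

Lemma integrable01Z f (a : R) : mu.-integrable `[0, 1] (EFin \o f) ->
  mu.-integrable `[0, 1] (EFin \o (fun x => a * f x)).
Proof. by move=> fi; exact: (integrableZl _ a fi). Qed.

Definition power_integral (k : nat) (p : R) f : R :=
  \int[mu]_(x in `[0, 1]) (taylor_rem k f x `^ p).

Section OneFunction.
Variables (k : nat) (p L : R) (f : R -> R).
Hypotheses (p01 : 0 < p < 1) (cf : convex_fct f) (Lf : lipschitz_fct L f).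

Lemma taylor_rem_integrable : mu.-integrable `[0, 1] (EFin \o taylor_rem k f).
Proof.
apply: bounded_integrable_itv; first exact: taylor_rem_measurable Lf.
by move=> x _; exact: taylor_rem_bound Lf.
Qed.

Lemma taylor_power_measurable (D : set R) : measurable D ->
  measurable_fun D (fun x => taylor_rem k f x `^ p).
Proof.
move=> mD; apply: (measurableT_comp (measurable_powR p)).
exact: taylor_rem_measurable Lf.
Qed.

Lemma taylor_power_bound : exists c, forall x, `|taylor_rem k f x `^ p| <= c.
Proof.
have [C C0 CP] := powR_sublinear p01 ltr01.
exists (C + k.+1%:R ^+ 2 * (L * k.+1%:R^-1 + L * k.+1%:R^-1)) => x.
rewrite ger0_norm ?powR_ge0//; apply: le_trans (CP _ (taylor_rem_ge0 k x cf)) _.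
rewrite mul1r lerD2l; apply: le_trans (ler_norm _) _; exact: taylor_rem_bound.
Qed.

Lemma taylor_power_integrable :
  mu.-integrable `[0, 1] (EFin \o (fun x => taylor_rem k f x `^ p)).
Proof.
have [c cP] := taylor_power_bound.
apply: (bounded_integrable_itv (c := c)); first exact: taylor_power_measurable.
by move=> x _; exact: cP.
Qed.

Lemma power_integral_ge0 : 0 <= power_integral k p f.
Proof. by apply: Rintegral_ge0 => x _; exact: powR_ge0. Qed.

Lemma Rintegral01_cst (c : R) : \int[mu]_(x in `[0, 1]) c = c.
Proof.
by rewrite Rintegral_cst//= lebesgue_measure_itv/= lte_fin ltr01 oppr0 addr0 mulr1.
Qed.

Lemma power_integral_le C e : 0 <= e ->
  (forall r, 0 <= r -> r `^ p <= C + e * r) ->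
  power_integral k p f <= C + e * (2 * L).
Proof.
move=> e0 CP.
have iC : mu.-integrable `[0, 1] (EFin \o (fun=> C)).
  by apply: (bounded_integrable_itv (c := `|C|)).
have iR : mu.-integrable `[0, 1] (EFin \o (fun x => e * taylor_rem k f x)).
  have [B BP] : exists B, forall x, `|taylor_rem k f x| <= B.
    by eexists => x; exact: taylor_rem_bound Lf.
  apply: (bounded_integrable_itv (c := e * B)).
    by apply: measurable_funM; [exact: measurable_cst|exact: taylor_rem_measurable Lf].
  by move=> x _; rewrite normrM ger0_norm//; apply: ler_wpM2l.
apply: (@le_trans _ _ (\int[mu]_(x in `[0, 1]) (C + e * taylor_rem k f x))).
  apply: le_Rintegral => //; first exact: taylor_power_integrable.
    exact: integrable01D.
  by move=> x _; apply: CP; exact: taylor_rem_ge0.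
rewrite RintegralD// Rintegral01_cst RintegralZl//; last exact: taylor_rem_integrable.
by rewrite lerD2l; apply: ler_wpM2l => //; exact: taylor_rem_integral.
Qed.

End OneFunction.

Section Pair.
Variables (f g : R -> R) (L p : R).
Hypothesis p01 : 0 < p < 1.
Let M x := Num.max (f x) (g x).
Let m x := Num.min (f x) (g x).
Hypotheses (cf : convex_fct f) (cg : convex_fct g).
Hypotheses (cM : convex_fct M) (cm : convex_fct m).
Hypotheses (Lf : lipschitz_fct L f) (Lg : lipschitz_fct L g).
Hypotheses (LM : lipschitz_fct L M) (Lm : lipschitz_fct L m).

Local Notation d := (@defect R f g p).
Let b (k : nat) (x : R) : R := if d k x == 0 then 0 else 1.

Let mb k (D : set R) : measurable D -> measurable_fun D (b k).
Proof.
move=> mD; apply: (measurable_funS measurableT (@subsetT _ D)).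
apply: measurable_fun_ifT => //.
apply: measurable_fun_eqr; last exact: measurable_cst.
apply: measurable_funB; apply: measurable_funD.
- exact: (taylor_power_measurable _ _ cM LM).
- exact: (taylor_power_measurable _ _ cm Lm).
- exact: (taylor_power_measurable _ _ cf Lf).
- exact: (taylor_power_measurable _ _ cg Lg).
Qed.

Let b01 k x : 0 <= b k x <= 1.
Proof. by rewrite /b; case: ifP; rewrite lexx ler01. Qed.

Let ib k : mu.-integrable `[0, 1] (EFin \o b k).
Proof.
apply: (bounded_integrable_itv (c := 1)); first exact: mb.
by move=> x _; have /andP[b0 b1] := b01 k x; rewrite ger0_norm.
Qed.

(** Dominated convergence applies to the indicator functions of the supports of the
    defects, although the defects themselves may be unbounded in [k]. *)
Lemma defect_support_cvg : \int[mu]_(x in `[0, 1]) b k x @[k --> \oo] --> (0 : R).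
Proof.
have mN : measurable (right_isolated f g : set R).
  by apply: countable_measurable; [exact: measurable_set1|exact: countable_right_isolated].
have := @dominated_convergence _ _ R mu `[0, 1]%classic _ (fun k => EFin \o b k)
  (fun=> 0%E) (fun=> 1%E).
case=> //.
- by move=> k; apply/measurable_EFinP; exact: mb.
- exists (right_isolated f g); split=> //.
    by apply: countable_lebesgue_measure0; exact: countable_right_isolated.
  move=> x /= H; apply: contrapT => nx; apply: H => _.
  have h := defect_eventually0 p cf cg cM cm Lf Lg nx.
  apply: cvg_near_cst.
  by apply: filterS h => k; rewrite /b /= => ->; rewrite eqxx.
- by apply: (bounded_integrable_itv (c := 1)) => // x _; rewrite normr1.
- apply: aeW => x k _ /=; have /andP[b0 b1] := b01 k x.
  by rewrite lee_fin ger0_norm.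
rewrite integral0 => _ _ /fine_cvg; exact.
Qed.

(** The defect is at most [4 * C] on its support plus [e1] times the sum of the four
    remainders. The supports shrink to a null set, and the remainders have bounded
    integrals. *)
Lemma power_integral_defect_cvg :
  (power_integral k p M + power_integral k p m) -
  (power_integral k p f + power_integral k p g) @[k --> \oo] --> (0 : R).
Proof.
have iP k h : convex_fct h -> lipschitz_fct L h ->
    mu.-integrable `[0, 1] (EFin \o (fun x => taylor_rem k h x `^ p)).
  by move=> ch Lh; exact: taylor_power_integrable Lh.
have L0 : 0 <= L.
  by have := Lf 1 0; rewrite subr0 normr1 mulr1; exact: le_trans.
apply/cvgr0Pnorm_le => // e e0.
pose e1 := e / (2 * (8 * L + 1)).
have e10 : 0 < e1 by rewrite divr_gt0// mulr_gt0//; lra.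
have [C C0 CP] := powR_sublinear p01 e10.
have /cvgr0Pnorm_le /(_ (e / (8 * C))) := defect_support_cvg.
have eC : 0 < e / (8 * C) by rewrite divr_gt0// mulr_gt0.
move=> /(_ eC) H; apply: filterS H => k.
rewrite ger0_norm; last by apply: Rintegral_ge0 => x _; have /andP[] := b01 k x.
move=> bk.
pose S x := taylor_rem k M x + taylor_rem k m x + (taylor_rem k f x + taylor_rem k g x).
have iR h : convex_fct h -> lipschitz_fct L h ->
    mu.-integrable `[0, 1] (EFin \o taylor_rem k h).
  by move=> ch Lh; exact: taylor_rem_integrable Lh.
have iS1 : mu.-integrable `[0, 1] (EFin \o (fun x => taylor_rem k M x + taylor_rem k m x)).
  by apply: integrable01D; exact: iR.
have iS2 : mu.-integrable `[0, 1] (EFin \o (fun x => taylor_rem k f x + taylor_rem k g x)).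
  by apply: integrable01D; exact: iR.
have iS : mu.-integrable `[0, 1] (EFin \o S) by exact: integrable01D.
have iMm : mu.-integrable `[0, 1]
    (EFin \o (fun x => taylor_rem k M x `^ p + taylor_rem k m x `^ p)).
  by apply: integrable01D; exact: iP.
have ifg : mu.-integrable `[0, 1]
    (EFin \o (fun x => taylor_rem k f x `^ p + taylor_rem k g x `^ p)).
  by apply: integrable01D; exact: iP.
have id : mu.-integrable `[0, 1] (EFin \o d k) by exact: integrable01B.
have -> : power_integral k p M + power_integral k p m -
  (power_integral k p f + power_integral k p g) = \int[mu]_(x in `[0, 1]) d k x.
  by rewrite RintegralB// !RintegralD//; exact: iP.
apply: le_trans (le_normr_Rintegral _ id) _ => //.
have i4b : mu.-integrable `[0, 1] (EFin \o (fun x => 4 * C * b k x)).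
  by apply: integrable01Z; exact: ib.
have ieS : mu.-integrable `[0, 1] (EFin \o (fun x => e1 * S x)).
  exact: integrable01Z.
have ins : mu.-integrable `[0, 1] (EFin \o (fun x => `|d k x|)) by exact: integrable_norm.
apply: (@le_trans _ _ (\int[mu]_(x in `[0, 1]) (4 * C * b k x + e1 * S x))).
  apply: le_Rintegral => //; first exact: integrable01D.
  move=> x _; have S0 : 0 <= S x by rewrite !addr_ge0 ?taylor_rem_ge0.
  rewrite /b; case: eqVneq => [->|_]; first by rewrite normr0 mulr0 add0r mulr_ge0// ltW.
  rewrite mulr1 /defect; apply: le_trans (ler_normB _ _) _.
  rewrite !ger0_norm ?addr_ge0 ?powR_ge0//.
  have := CP _ (taylor_rem_ge0 k x cM); have := CP _ (taylor_rem_ge0 k x cm).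
  have := CP _ (taylor_rem_ge0 k x cf); have := CP _ (taylor_rem_ge0 k x cg).
  rewrite /S !mulrDr -/M -/m; lra.
rewrite RintegralD// !RintegralZl//.
have B : \int[mu]_(x in `[0, 1]) S x <= 8 * L.
  rewrite /S RintegralD// !RintegralD//; try exact: iR.
  have := taylor_rem_integral k cM LM; have := taylor_rem_integral k cm Lm.
  have := taylor_rem_integral k cf Lf; have := taylor_rem_integral k cg Lg.
  lra.
have h1 : 4 * C * (\int[mu]_(x in `[0, 1]) b k x) <= e / 2.
  apply: le_trans (ler_wpM2l _ bk) _; first by rewrite mulr_ge0// ltW.
  by rewrite le_eqVlt; apply/orP; left; apply/eqP; field; rewrite gt_eqF.
have h2 : e1 * (\int[mu]_(x in `[0, 1]) S x) <= e / 2.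
  apply: le_trans (ler_wpM2l (ltW e10) B) _.
  have L1 : 0 < 8 * L + 1 by lra.
  have -> : e1 * (8 * L) = e / 2 * (8 * L / (8 * L + 1)).
    by rewrite /e1; field; rewrite gt_eqF.
  rewrite ler_piMr//; first by rewrite divr_ge0// ltW.
  by rewrite ler_pdivrMr//; lra.
by rewrite [leRHS]splitr; apply: lerD.
Qed.

End Pair.
End PowerIntegral.

(** * A valuation of fractional degree in the plane *)

Section Plane.
Context {R : realType}.
Implicit Types (K : set 'rV[R]_2).

Definition pairing (y : 'rV[R]_2) (x : R) : R := y ord0 ord0 * x + y ord0 ord_max.

(** The support function at the directions [(x, 1)]. *)
Definition support_on_line K (x : R) : R := sup [set pairing y x | y in K].

Lemma pairing_continuous x : continuous (fun y => pairing y x).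
Proof.
have c0 := @coord_continuous R 1 2 ord0.
by move=> y; exact: (cvgD (cvgM (c0 ord0 y) (cvg_cst x)) (c0 ord_max y)).
Qed.

Lemma support_eq K x v : (forall z, K z -> pairing z x <= v) ->
  (exists2 y, K y & pairing y x = v) -> support_on_line K x = v.
Proof.
move=> H [y Ky Ey]; apply/eqP; rewrite eq_le; apply/andP; split.
  apply: ge_sup; first by exists (pairing y x), y.
  by move=> _ [z Kz <-]; exact: H.
rewrite -Ey; apply: ub_le_sup; last by exists y.
by exists v => _ [z Kz <-]; exact: H.
Qed.

Lemma supportP K x : convex_compact K -> K !=set0 ->
  (forall z, K z -> pairing z x <= support_on_line K x) /\
  exists2 y, K y & pairing y x = support_on_line K x.
Proof.
move=> [_ kK] K0.
have [y /set_mem Ky ymax] := EVT_max_rV K0 kK (continuous_subspaceT (@pairing_continuous x)).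
have E : support_on_line K x = pairing y x.
  apply: support_eq; last by exists y.
  by move=> z Kz; apply: ymax; exact: mem_set.
rewrite E; split; last by exists y.
by move=> z Kz; apply: ymax; exact: mem_set.
Qed.

Lemma support_convex K : convex_compact K -> K !=set0 -> convex_fct (support_on_line K).
Proof.
move=> cK K0 x y t /andP[t0 t1].
have [_ [z Kz <-]] := supportP (t * x + (1 - t) * y) cK K0.
have [Hx _] := supportP x cK K0; have [Hy _] := supportP y cK K0.
have -> : pairing z (t * x + (1 - t) * y) = t * pairing z x + (1 - t) * pairing z y.
  by rewrite /pairing; ring.
by apply: lerD; apply: ler_wpM2l; rewrite ?subr_ge0//; [exact: Hx|exact: Hy].
Qed.

Lemma support_lipschitz K r : convex_compact K -> K !=set0 ->
  (forall y, K y -> `|y ord0 ord0| <= r) -> lipschitz_fct r (support_on_line K).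
Proof.
move=> cK K0 Kr.
have le x y : support_on_line K x - support_on_line K y <= r * `|x - y|.
  have [_ [z Kz <-]] := supportP x cK K0; have [Hy _] := supportP y cK K0.
  apply: (@le_trans _ _ (pairing z x - pairing z y)); first by rewrite lerB// Hy.
  have -> : pairing z x - pairing z y = z ord0 ord0 * (x - y) by rewrite /pairing; ring.
  by rewrite (le_trans (ler_norm _))// normrM ler_wpM2r// Kr.
by move=> x y; rewrite ler_norml le andbT lerNl opprB distrC le.
Qed.

Lemma supportU K L x : convex_body K -> convex_body L ->
  support_on_line (K `|` L) x = Num.max (support_on_line K x) (support_on_line L x).
Proof.
move=> /convex_bodyE[cK K0] /convex_bodyE[cL L0].
have [HK [a Ka aE]] := supportP x cK K0; have [HL [b Lb bE]] := supportP x cL L0.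
apply: support_eq => [z [Kz|Lz]|].
- by rewrite le_max HK.
- by rewrite le_max HL// orbT.
have [h|h] := leP (support_on_line K x) (support_on_line L x).
  by exists b => //; right.
by exists a => //; left.
Qed.

(** On a segment joining maximizers in the two pieces of a convex union, the form
    stays above the smaller maximum, and the segment meets the intersection. *)
Lemma supportI K L x : convex_body K -> convex_body L -> convex_body (K `|` L) ->
  support_on_line (K `&` L) x = Num.min (support_on_line K x) (support_on_line L x).
Proof.
move=> /convex_bodyE[cK K0] /convex_bodyE[cL L0] /convex_bodyE[cKL _].
have [HK [a Ka aE]] := supportP x cK K0; have [HL [b Lb bE]] := supportP x cL L0.
have [t /andP[t0 t1] [Kt Lt]] := convexU_segment_meet cK cL cKL Ka Lb.
have le z : (K `&` L) z -> pairing z x <= Num.min (support_on_line K x) (support_on_line L x).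
  by move=> [Kz Lz]; rewrite le_min HK// HL.
apply: support_eq => //; exists (t *: a + (1 - t) *: b) => //.
apply/eqP; rewrite eq_le le//=.
have -> : pairing (t *: a + (1 - t) *: b) x = t * pairing a x + (1 - t) * pairing b x.
  by rewrite /pairing !mxE; ring.
rewrite aE bE ge_min; have [h|h] := leP (support_on_line K x) (support_on_line L x).
  by apply/orP; left; nra.
by apply/orP; right; nra.
Qed.

Lemma support_shift K v : convex_body K ->
  support_on_line [set y + v | y in K] =
  fun x => support_on_line K x + (v ord0 ord0 * x + v ord0 ord_max).
Proof.
move=> /convex_bodyE[cK K0]; apply/funext => x.
have [HK [a Ka aE]] := supportP x cK K0.
have E z : pairing (z + v) x = pairing z x + (v ord0 ord0 * x + v ord0 ord_max).
  by rewrite /pairing !mxE; ring.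
apply: support_eq; last by exists (a + v); [exists a|rewrite E aE].
by move=> _ [z Kz <-]; rewrite E lerD2r HK.
Qed.

Lemma support_scale K l : 0 <= l -> convex_body K ->
  support_on_line [set l *: y | y in K] = fun x => l * support_on_line K x.
Proof.
move=> l0 /convex_bodyE[cK K0]; apply/funext => x.
have [HK [a Ka aE]] := supportP x cK K0.
have E z : pairing (l *: z) x = l * pairing z x by rewrite /pairing !mxE; ring.
apply: support_eq; last by exists (l *: a); [exists a|rewrite E aE].
by move=> _ [z Kz <-]; rewrite E ler_wpM2l// HK.
Qed.

(** Its upper boundary is an arc of a parabola, chosen so that the support function
    is [x ^ 2 / 2] for [x] in [0, 2]. *)
Definition parabola_body : set 'rV[R]_2 :=
  [set y | 0 <= y ord0 ord0 <= 2 /\ -2 <= y ord0 ord_max <= - (y ord0 ord0 ^+ 2 / 2)].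

Lemma convex_body_parabola : convex_body parabola_body.
Proof.
apply/convex_bodyE; split; last first.
  by exists 0; rewrite /parabola_body/= !mxE; split; apply/andP; split; lra.
split.
  move=> x y t [/andP[a1 a2] /andP[a3 a4]] [/andP[b1 b2] /andP[b3 b4]] /andP[t0 t1].
  rewrite /parabola_body/= !mxE; split; apply/andP; split; [nra|nra|nra|].
  have : 0 <= t * (1 - t) * (x ord0 ord0 - y ord0 ord0) ^+ 2.
    by apply: mulr_ge0; [apply: mulr_ge0 => //; rewrite subr_ge0|exact: sqr_ge0].
  have : t * x ord0 ord_max <= t * - (x ord0 ord0 ^+ 2 / 2) by exact: ler_wpM2l.
  have : (1 - t) * y ord0 ord_max <= (1 - t) * - (y ord0 ord0 ^+ 2 / 2).
    by apply: ler_wpM2l => //; rewrite subr_ge0.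
  nra.
apply: bounded_closed_compact.
  exists 2; split; first exact: num_real.
  move=> M M2 y [/andP[y1 y2] /andP[y3 y4]].
  have M0 : 0 <= M by lra.
  suff : mx_norm y <= M by [].
  rewrite mx_normrE; apply/bigmax_leP; split => // -[i j] _ /=.
  rewrite (ord1 i); have [->|->] : j = ord0 \/ j = ord_max.
    by case: j => -[|[|//]] ?; [left|right]; exact: val_inj.
    by rewrite ler_norml; apply/andP; split; lra.
  have : 0 <= y ord0 ord0 ^+ 2 by exact: sqr_ge0.
  by move=> ?; rewrite ler_norml; apply/andP; split; lra.
have -> : parabola_body =
  (fun y : 'rV[R]_2 => y ord0 ord0) @^-1` [set x | 0 <= x] `&`
  (fun y : 'rV[R]_2 => y ord0 ord0) @^-1` [set x | x <= 2] `&`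
  (fun y : 'rV[R]_2 => y ord0 ord_max) @^-1` [set x | -2 <= x] `&`
  (fun y : 'rV[R]_2 => y ord0 ord_max + y ord0 ord0 * y ord0 ord0 / 2) @^-1` [set x | x <= 0].
  apply/seteqP; split => y /=; rewrite /parabola_body/= expr2.
    by move=> [/andP[h1 h2] /andP[h3 h4]]; do !split => //; lra.
  by move=> [[[h1 h2] h3] h4]; split; apply/andP; split => //; lra.
have c0 i : continuous (fun y : 'rV[R]_2 => y ord0 i) by exact: coord_continuous.
apply: closedI; [apply: closedI; [apply: closedI|]|]; apply: closed_comp.
- by move=> y _; exact: c0.
- exact: closed_ge.
- by move=> y _; exact: c0.
- exact: closed_le.
- by move=> y _; exact: c0.
- exact: closed_ge.
- move=> y _.
  exact: (cvgD (c0 ord_max y) (cvgM (cvgM (c0 ord0 y) (c0 ord0 y)) (cvg_cst _))).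
- exact: closed_le.
Qed.

Lemma support_parabola x : 0 <= x <= 2 -> support_on_line parabola_body x = x ^+ 2 / 2.
Proof.
move=> /andP[x0 x2]; apply: support_eq.
  move=> z [/andP[z1 z2] /andP[z3 z4]]; rewrite /pairing.
  have : 0 <= (z ord0 ord0 - x) ^+ 2 by exact: sqr_ge0.
  nra.
exists (\row_j (if j == ord0 then x else - (x ^+ 2 / 2))).
  by rewrite /parabola_body/= !mxE/=; split; apply/andP; split => //; nra.
by rewrite /pairing !mxE/=; field.
Qed.

Lemma support_parabola_ge x y : 0 <= x <= 2 ->
  x * y - x ^+ 2 / 2 <= support_on_line parabola_body y.
Proof.
move=> /andP[x0 x2]; have /convex_bodyE[cK K0] := convex_body_parabola.
have [H _] := supportP y cK K0.
have := H (\row_j (if j == ord0 then x else - (x ^+ 2 / 2))).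
rewrite /pairing !mxE/= => -> //.
by rewrite /parabola_body/= !mxE/=; split; apply/andP; split => //; nra.
Qed.

Lemma taylor_rem_parabola k x : 0 <= x <= 1 ->
  taylor_rem k (support_on_line parabola_body) x = 2^-1.
Proof.
move=> /andP[x0 x1]; have /convex_bodyE[cK K0] := convex_body_parabola.
have cf := support_convex cK K0.
have x02 : 0 <= x <= 2 by apply/andP; split; lra.
have k0 : 0 <= k.+1%:R^-1 :> R by rewrite invr_ge0.
have k1 : k.+1%:R^-1 <= 1 :> R by rewrite invf_le1// ler1n.
have D : right_derivative (support_on_line parabola_body) x = x.
  apply: right_derivative_eq => // [h h0|e e0].
    rewrite /slope ler_pdivlMr// (support_parabola x02).
    have := support_parabola_ge (x + h) x02.
    set s := support_on_line _ _; rewrite expr2 mulrDr; lra.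
  pose h : R := Num.min e 1.
  have h0 : 0 < h by rewrite lt_min e0 ltr01.
  have h1 : h <= 1 by rewrite ge_min lexx orbT.
  have he : h <= e by rewrite ge_min lexx.
  have xh : 0 <= x + h <= 2 by clearbody h; apply/andP; split; lra.
  exists h => //; rewrite /slope (support_parabola x02) (support_parabola xh).
  rewrite ltr_pdivrMr//; nra.
have xk : 0 <= x + k.+1%:R^-1 <= 2.
  by rewrite addr_ge0// (le_trans (lerD x1 k1)).
rewrite /taylor_rem D (support_parabola x02) (support_parabola xk).
by field; rewrite addrC natr1.
Qed.

(** The limit, along an ultrafilter, of the means over [x] in [0, 1] of the [p]-th
    powers of the discrete second derivatives of the support function. Translations
    add affine functions and do not change the remainders; dilations multiply them;
    the defect of additivity tends to 0. The parabola has constant remainders. *)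
Lemma realizable_degree_plane (p : R) : 0 < p < 1 -> realizable_degree 2 p.
Proof.
move=> p01.
have [U [UU FU]] := ultraFilterLemma (eventually_filter : ProperFilter \oo).
pose I (K : set 'rV[R]_2) k := power_integral k p (support_on_line K).
have cb K : convex_body K -> convex_compact K /\ K !=set0 by move=> /convex_bodyE.
have cs K : convex_body K -> convex_fct (support_on_line K).
  by move=> /cb[cK K0]; exact: support_convex.
have [C C0 CP] := powR_sublinear p01 ltr01.
have Ib K r : convex_body K -> (forall y, K y -> `|y ord0 ord0| <= r) ->
    forall k, `|I K k| <= C + 2 * r.
  move=> bK Kr k; have [cK K0] := cb K bK.
  rewrite ger0_norm ?power_integral_ge0//.
  rewrite -[2 * r]mul1r; apply: power_integral_le => //; first exact: cs.
  exact: support_lipschitz.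
have Ib' K : convex_body K -> exists c, forall k, `|I K k| <= c.
  move=> bK; have [cK K0] := cb K bK; have [r r0 rK] := compact_coord_bounded cK.2.
  by exists (C + 2 * r%:R); apply: Ib => // y; exact: rK.
have Ishift K v : convex_body K -> I [set y + v | y in K] = I K.
  move=> bK; apply/funext => k; apply: eq_Rintegral => x _; congr (_ `^ _).
  have bKv := convex_body_shift v bK.
  have := cs _ bKv; rewrite support_shift// => cs'.
  rewrite /taylor_rem right_derivative_affine//; last exact: cs.
  by ring.
have Iscale K l : 0 <= l -> convex_body K ->
    I [set l *: y | y in K] = fun k => l `^ p * I K k.
  move=> l0 bK; have [cK K0] := cb K bK.
  have [r r0 rK] := compact_coord_bounded cK.2.
  have Lip : lipschitz_fct r%:R (support_on_line K).
    by apply: support_lipschitz => // y; exact: rK.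
  apply/funext => k; rewrite /I /power_integral -RintegralZl//; last first.
    by apply: (taylor_power_integrable _ p01 _ Lip); exact: cs.
  have := cs _ (convex_body_scale l bK); rewrite support_scale// => cs'.
  apply: eq_Rintegral => x _; rewrite -powRM ?taylor_rem_ge0//; last exact: cs.
  congr (_ `^ _); rewrite /taylor_rem right_derivative_scale//; last exact: cs.
  by ring.
exists (fun K => ulim U (I K)); split.
- move=> K L bK bL bKL.
  have bI : convex_body (K `&` L) by exact: convex_bodyI_of_convexU.
  have [c cP] := Ib' K bK; have [c' cP'] := Ib' L bL.
  have [c1 cP1] := Ib' _ bKL; have [c2 cP2] := Ib' _ bI.
  have E1 := @ulimD _ _ U (I (K `|` L)) (I (K `&` L)) _ _ UU cP1 cP2.
  have E2 := @ulimD _ _ U (I K) (I L) _ _ UU cP cP'.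
  etransitivity; first exact: (esym E1).
  etransitivity; last exact: E2.
  have b1 k : `|I (K `|` L) k + I (K `&` L) k| <= c1 + c2.
    by rewrite (le_trans (ler_normD _ _))// lerD.
  have b2 k : `|I K k + I L k| <= c + c'.
    by rewrite (le_trans (ler_normD _ _))// lerD.
  have b3 k : `|(-1) * (I K k + I L k)| <= c + c' by rewrite mulN1r normrN.
  apply/eqP; rewrite -subr_eq0 -mulN1r; apply/eqP.
  have E3 := @ulimZ _ _ U (fun k => I K k + I L k) _ (-1) UU b2.
  have E4 := @ulimD _ _ U (fun k => I (K `|` L) k + I (K `&` L) k)
    (fun k => (-1) * (I K k + I L k)) _ _ UU b1 b3.
  rewrite -E3 -E4; apply: (ulim_cvg UU FU).
  have [cK K0] := cb _ bK; have [cL L0] := cb _ bL.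
  have [cKL KL0] := cb _ bKL; have [cI I0] := cb _ bI.
  have [r r0 rK] := compact_coord_bounded cKL.2.
  have Lip J : convex_body J -> J `<=` K `|` L -> lipschitz_fct r%:R (support_on_line J).
    move=> /cb[cJ J0] sJ; apply: support_lipschitz => // y /sJ; exact: rK.
  have EM : support_on_line (K `|` L) =
      fun x => Num.max (support_on_line K x) (support_on_line L x).
    by apply/funext => x; exact: supportU.
  have Em : support_on_line (K `&` L) =
      fun x => Num.min (support_on_line K x) (support_on_line L x).
    by apply/funext => x; exact: supportI.
  have := @power_integral_defect_cvg R (support_on_line K) (support_on_line L) r%:R p p01.
  rewrite -EM -Em => H.
  have := H (cs _ bK) (cs _ bL) (cs _ bKL) (cs _ bI)
    (Lip _ bK (@subsetUl _ _ _)) (Lip _ bL (@subsetUr _ _ _))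
    (Lip _ bKL (@subset_refl _ _)) (Lip _ bI (fun x h => or_introl h.1)).
  by under eq_fun do rewrite -mulN1r.
- by move=> K v bK; rewrite Ishift.
- exists (C + 2 * 1) => _ [K [bK sK] <-].
  apply: ulim_norm_le => //; apply: Ib => // y /sK; exact: euclidean_ball_coord.
- exists parabola_body; first exact: convex_body_parabola.
  have -> : I parabola_body = fun=> (2^-1) `^ p.
    apply/funext => k; rewrite -[RHS](@Rintegral01_cst R); apply: eq_Rintegral => x.
    by rewrite inE/= in_itv/= => x01; rewrite taylor_rem_parabola.
  by rewrite ulim_cst// gt_eqF// powR_gt0// invr_gt0.
- move=> l K l0 _ bK; rewrite Iscale//.
  by have [c cP] := Ib' K bK; exact: (ulimZ _ UU cP).
Qed.

End Plane.

(** * The theorem *)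

Lemma realizable_degree_raise (R : realType) (n k : nat) (m : R) : 0 <= m ->
  realizable_degree n m -> realizable_degree (k + n) (m + k%:R).
Proof.
move=> m0 nm; elim: k => [|k IH]; first by rewrite addr0.
by rewrite -natr1 addrA; apply: realizable_degreeS => //; rewrite addr_ge0.
Qed.

Lemma realizable_degree_widen (R : realType) (n k : nat) (m : R) : (k <= n)%N ->
  realizable_degree k m -> realizable_degree n m.
Proof.
move=> kn; apply: (@realizable_degree_select _ _ _ (widen_ord kn)) => i j.
by move=> /(congr1 val)/= ij; exact: val_inj.
Qed.

Lemma realizable_degree_nat (R : realType) (n : nat) :
  @realizable_degree R n n%:R.
Proof.
rewrite -[X in realizable_degree X]addn0 -[n%:R]add0r.
exact/realizable_degree_raise/realizable_degree0.
Qed.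

Theorem theorem5p9 (R : realType) (n : nat) :
  (forall (V : set 'rV[R]_n -> R) (m : R),
     valuation V -> translation_invariant V -> bounded_on_ball V ->
     nonzero_on_bodies V -> homogeneous m V ->
     (0 <= m <= n%:R - 1) \/ m = n%:R) /\
  (forall m : R, (0 <= m <= n%:R - 1) \/ m = n%:R ->
     exists V : set 'rV[R]_n -> R,
       [/\ valuation V, translation_invariant V, bounded_on_ball V,
           nonzero_on_bodies V & homogeneous m V]).
Proof.
split=> [V m vV tV bV nV hV|m].
  exact: (degree_restriction vV tV bV hV nV).
case=> [/andP[m0 mn]|->]; last exact: realizable_degree_nat.
(* A fractional part of [m] comes from the plane, so that [k + 2] dimensions are
   used, where [k] is the integer part; [k < m <= n - 1] leaves room for them. *)
have /andP[k1 k2] := truncn_itv m0; set k := Num.truncn m in k1 k2.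
move: k2; rewrite -natr1 => k2.
have [mk|mk] := eqVneq m k%:R.
  rewrite mk; apply: (@realizable_degree_widen _ _ k).
    by rewrite -(ler_nat R); lra.
  exact: realizable_degree_nat.
have km : k%:R < m by rewrite lt_neqAle eq_sym mk.
apply: (@realizable_degree_widen _ _ (k + 2)).
  by rewrite addn2 -(ltr_nat R) -natr1; lra.
rewrite -[m](subrK k%:R); apply: realizable_degree_raise.
  by rewrite subr_ge0 ltW.
by apply: realizable_degree_plane; apply/andP; split; lra.
Qed.
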